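(* The set $\mathcal{B}=\{q^{-\frac12ab}X_m^aX_{m+1}^b\mid m\in\mathbb{Z},(a,b)\in\mathbb{Z}_{\ge0}^2\}\cup\{F_n(X_\delta)\mid n\ge1\}$ is the canonical basis of $\mathcal{A}_q(1,4)$: it is a $\mathbb{Z}[q^{\pm\frac12}]$-basis of $\mathcal{A}_q(1,4)$ and every positive element of $\mathcal{A}_q(1,4)$ is an $\mathbb{N}[q^{\pm\frac12}]$-linear combination of elements of $\mathcal{B}$.
   Context: Let $\mathcal{T}$ be the quantum torus over $\mathbb{Z}[q^{\pm\frac12}]$ generated by $X_1^{\pm1},X_2^{\pm1}$ with $X_1X_2=qX_2X_1$, with skew field of fractions $\mathcal{F}$. Define $X_k\in\mathcal{F}$ ($k\in\mathbb{Z}$) by $X_{k-1}X_{k+1}=q^{\frac12}X_k+1$ for $k$ odd and $X_{k-1}X_{k+1}=q^2X_k^4+1$ for $k$ even; $\mathcal{A}_q(1,4)$ is the $\mathbb{Z}[q^{\pm\frac12}]$-subalgebra of $\mathcal{F}$ generated by all $X_k$. Put $X^{(a,b)}=q^{-\frac12ab}X_1^aX_2^b$ and $X_\delta=X^{(-1,-2)}+X^{(-1,2)}+X^{(1,-2)}+(q^{-\frac12}+q^{\frac12})X^{(0,-2)}$. Chebyshev polynomials: $F_0=1,F_1=x,F_2=x^2-2$, $F_{n+1}=F_nx-F_{n-1}$ for $n\ge2$. An element $Y\in\mathcal{A}_q(1,4)$ is positive if for every $m\in\mathbb{Z}$ the coefficients of its Laurent expansion in the cluster variables $X_m,X_{m+1}$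 belong to $\mathbb{N}[q^{\pm\frac12}]$. A $\mathbb{Z}[q^{\pm\frac12}]$-basis $\mathcal{C}$ is called the canonical basis if every positive element is an $\mathbb{N}[q^{\pm\frac12}]$-linear combination of elements of $\mathcal{C}$. *)

(* Defs.v *)
(* The skew field F is modelled as an arbitrary division
   ring D containing a copy of the quantum torus. *)
From HB Require Import structures.
From mathcomp Require Import all_boot all_order all_algebra.
Set Implicit Arguments. Unset Strict Implicit. Unset Printing Implicit Defensive.
Import Order.TTheory GRing.Theory Num.Theory.
Local Open Scope ring_scope.

(* v plays the role of q^{1/2}; q = v^2. *)

(* Hypotheses making D (a model of) the skew field of fractions of the
   quantum torus: D is a division ring, v is central, x1 x2 = q x2 x1, and
   the monomials v^k x1^a x2^b (k,a,b in Z) are Z-linearly independent. *)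
Definition qtorus_model (D : unitRingType) (v x1 x2 : D) : Prop :=
  [/\ forall y : D, y != 0 -> y \is a GRing.unit,
      forall y : D, v * y = y * v,
      x1 * x2 = v ^+ 2 * x2 * x1 &
      forall (s : seq (int * int * int)) (c : int * int * int -> int),
        uniq s ->
        \sum_(t <- s) (c t)%:~R * (v ^ t.1.1 * x1 ^ t.1.2 * x2 ^ t.2) = 0 ->
        forall t, t \in s -> c t = 0].

(* right-hand side of the exchange relation X_{k-1} X_{k+1} = exch k X_k:
   k odd : q^{1/2} y + 1 ;  k even : q^2 y^4 + 1 *)
Definition exch (D : unitRingType) (v : D) (kodd : bool) (y : D) : D :=
  if kodd then v * y + 1 else v ^+ 4 * y ^+ 4 + 1.

(* fwd n = (X_{n+1}, X_{n+2}) *)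
Fixpoint clfwd (D : unitRingType) (v x1 x2 : D) (n : nat) : D * D :=
  match n with
  | 0%N => (x1, x2)
  | n'.+1 => let p := clfwd v x1 x2 n' in
             (p.2, p.1^-1 * exch v (odd n') p.2)
  end.

(* bwd n = (X_{1-n}, X_{2-n}) *)
Fixpoint clbwd (D : unitRingType) (v x1 x2 : D) (n : nat) : D * D :=
  match n with
  | 0%N => (x1, x2)
  | n'.+1 => let p := clbwd v x1 x2 n' in
             (exch v (~~ odd n') p.1 * p.2^-1, p.1)
  end.

Definition clvar (D : unitRingType) (v x1 x2 : D) (k : int) : D :=
  match k with
  | Posz n.+1 => (clfwd v x1 x2 n).1
  | Posz 0 => (clbwd v x1 x2 1).1
  | Negz n => (clbwd v x1 x2 n.+2).1
  end.

Inductive inA (D : unitRingType) (v x1 x2 : D) : D -> Prop :=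
  | inA_X k : inA v x1 x2 (clvar v x1 x2 k)
  | inA_1 : inA v x1 x2 1
  | inA_v : inA v x1 x2 v
  | inA_vinv : inA v x1 x2 v^-1
  | inA_add y z : inA v x1 x2 y -> inA v x1 x2 z -> inA v x1 x2 (y + z)
  | inA_opp y : inA v x1 x2 y -> inA v x1 x2 (- y)
  | inA_mul y z : inA v x1 x2 y -> inA v x1 x2 z -> inA v x1 x2 (y * z).

Definition Xab (D : unitRingType) (v x1 x2 : D) (a b : int) : D :=
  v ^ (- (a * b)) * x1 ^ a * x2 ^ b.

Definition Xdelta (D : unitRingType) (v x1 x2 : D) : D :=
  Xab v x1 x2 (-1) (-2) + Xab v x1 x2 (-1) 2 + Xab v x1 x2 1 (-2)
  + (v^-1 + v) * Xab v x1 x2 0 (-2).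

Fixpoint chebF (D : unitRingType) (n : nat) (x : D) : D :=
  match n with
  | 0%N => 1
  | n'.+1 => match n' with
             | 0%N => x
             | n''.+1 => match n'' with
                         | 0%N => x * x - 2%:R
                         | _ => chebF n' x * x - chebF n'' x
                         end
             end
  end.

Definition Bset (D : unitRingType) (v x1 x2 : D) (y : D) : Prop :=
  (exists (m : int) (a b : nat),
      y = v ^ (- (a%:Z * b%:Z)) * clvar v x1 x2 m ^+ a
                                * clvar v x1 x2 (m + 1) ^+ b)
  \/ (exists n : nat, (1 <= n)%N /\ y = chebF n (Xdelta v x1 x2)).

Definition lpval (D : unitRingType) (v : D) (p : seq (int * int)) : D :=
  \sum_(t <- p) t.1%:~R * v ^ t.2.

Definition is_basis (D : unitRingType) (v x1 x2 : D) (C : D -> Prop) : Prop :=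
  [/\ forall y, C y -> inA v x1 x2 y,
      forall Y, inA v x1 x2 Y ->
        exists l : seq (seq (int * int) * D),
          (forall t, t \in l -> C t.2) /\
          Y = \sum_(t <- l) lpval v t.1 * t.2 &
      forall (ys : seq D) (lam : D -> seq (int * int)),
        uniq ys -> (forall y, y \in ys -> C y) ->
        \sum_(y <- ys) lpval v (lam y) * y = 0 ->
        forall y, y \in ys -> lpval v (lam y) = 0].

(* Y is positive: for every m, its Laurent expansion in X_m, X_{m+1} has
   coefficients in N[v^{+-1}] (a sum of terms n v^k X_m^a X_{m+1}^b, n : nat). *)
Definition positive (D : unitRingType) (v x1 x2 : D) (Y : D) : Prop :=
  forall m : int, exists l : seq (nat * int * int * int),
    Y = \sum_(t <- l) t.1.1.1%:R * v ^ t.1.1.2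
           * clvar v x1 x2 m ^ t.1.2 * clvar v x1 x2 (m + 1) ^ t.2.

Definition is_canonical_basis (D : unitRingType) (v x1 x2 : D)
    (C : D -> Prop) : Prop :=
  is_basis v x1 x2 C /\
  forall Y, inA v x1 x2 Y -> positive v x1 x2 Y ->
    exists l : seq (nat * int * D),
      (forall t, t \in l -> C t.2) /\
      Y = \sum_(t <- l) t.1.1%:R * v ^ t.1.2 * t.2.

(* Main.v *)
(** Write [E_i = X_{2i}], [O_i = X_{2i+1}], [z = X_delta]; every cluster
    [(X_m, X_{m+1})] again generates a quantum torus, so Laurent expansions in
    it are unique.

    Spanning: [v O_i = E_i E_{i+1} - 1], so the [E_i] generate the algebra.
    The element [z] has the same expansion in all clusters of a given parity
    and satisfies [z E_i = v E_{i-1} + v^-1 E_{i+1}].  It follows that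
    [E_i E_{j+1} - v^2 E_{i+1} E_j] is a polynomial in [z], hence, modulo
    shorter products, a product of [E]'s is determined up to a power of [v] by
    the sum of its indices and equals some [E_q^a E_{q+1}^b]; this is a
    combination of cluster monomials.

    Independence and positivity: for every finite part of the basis and every
    element [b] of it there are a cluster and an exponent at which [b] has a
    power of [v] as coefficient while the others have coefficient zero.  For
    [b] a monomial in the cluster [(X_m, X_{m+1})] one takes that cluster: all
    other basis elements have only terms with a negative exponent there.  For
    [b = F_n(z)] one takes a cluster far to the left and the exponent
    [(n, -2n)].  The terms of cluster monomials are controlled by the degrees
    of the [X_k] for suitable weights; the degree is a valuation, so it is
    computed by the tropical exchange relations. *)
Require Import Defs.
From HB Require Import structures.
From mathcomp Require Import all_boot all_order all_algebra.
From mathcomp Require Import ssrAC zify ring.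
Set Implicit Arguments. Unset Strict Implicit. Unset Printing Implicit Defensive.
Import Order.TTheory GRing.Theory Num.Theory.
Local Open Scope ring_scope.

(** * Powers, regrouping of sums, and induction over the integers *)

(** Taking for [r] a power of [v] times [p] yields the commutation rule of a quantum torus for all
    integer exponents. *)
Lemma semicommXz (D : unitRingType) (p q r : D) (a : int) :
  p \is a GRing.unit -> r \is a GRing.unit ->
  p * q = q * r -> p ^ a * q = q * r ^ a.
Proof.
move=> up ur pq; have pX n : p ^+ n * q = q * r ^+ n.
  by elim: n => [|n IHn]; rewrite ?mulr1 ?mul1r // exprSr -mulrA pq mulrA IHn -mulrA -exprSr.
case: a => n; rewrite ?NegzE -?exprnP ?exprnN; first exact: pX.
apply: (can_inj (mulKr (unitrX n.+1 up))).
by rewrite mulrA divrr ?unitrX // mul1r mulrA pX -mulrA divrr ?unitrX // mulr1.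
Qed.

(** Collects repeated keys, since linear independence is always stated for duplicate-free lists. *)
Lemma sum_by_key (V : nmodType) (T K : eqType) (f : T -> K) (s : seq T) (F : T -> V) :
  \sum_(t <- s) F t =
  \sum_(k <- undup [seq f t | t <- s]) \sum_(t <- s | f t == k) F t.
Proof.
rewrite (exchange_big_dep predT) //=; apply: eq_big_seq => t ts.
rewrite big_mkcond (bigD1_seq (f t)) ?undup_uniq ?mem_undup ?map_f //= eqxx.
by rewrite big1 ?addr0 // => k; rewrite eq_sym => /negbTE ->.
Qed.

Lemma int_shift_const (T : Type) (f : int -> T) :
  (forall i, f i = f (i + 1)) -> forall i, f i = f 0.
Proof.
move=> fS; elim/int_rect => [//|n <-|n <-]; first by rewrite [RHS]fS; congr f; lia.
by rewrite fS; congr f; lia.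
Qed.

Lemma int_parity (k : int) : exists i, k = 2 * i \/ k = 2 * i + 1.
Proof.
exists (divz k 2); have := divz_eq k 2; have := ltz_pmod k (isT : 0 < 2 :> int).
by have := modz_ge0 k (isT : 2 != 0 :> int); lia.
Qed.

(** * Laurent expansions in a quantum torus *)

Definition qmono (D : unitRingType) (v x y : D) (t : int * int * int) : D :=
  v ^ t.1.1 * x ^ t.1.2 * y ^ t.2.

(** The list may repeat or cancel monomials, so [G] bounds the support without any coefficient being
    computed. [G] sees the exponents of [x] and [y] only; the power of [v] belongs to the
    coefficient. *)
Definition laurent (D : unitRingType) (v x y : D) (G : pred (int * int)) (Y : D) :=
  exists s : seq (int * (int * int * int)),
    (forall t, t \in s -> G (t.2.1.2, t.2.2)) /\
    Y = \sum_(t <- s) t.1%:~R * qmono v x y t.2.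

Section Torus.
Variables (D : unitRingType) (v x y : D).
Hypothesis M : qtorus_model v x y.

Local Notation mono := (qmono v x y).
Local Notation mon k a b := (mono (k, a, b)).
Local Notation L := (laurent v x y).

Lemma unit_neq0 (Y : D) : Y != 0 -> Y \is a GRing.unit.
Proof. by case: M => + _ _ _; apply. Qed.

Lemma central_v (Y : D) : GRing.comm v Y.
Proof. by case: M => _ + _ _; apply. Qed.

Lemma central_vz (k : int) (Y : D) : v ^ k * Y = Y * v ^ k.
Proof. by symmetry; apply: commrXz; apply: commr_sym; apply: central_v. Qed.

Lemma mono_neq0 t : mono t != 0.
Proof.
apply/eqP => t0; case: M => _ _ _ /(_ [:: t] (fun=> 1)).
rewrite big_seq1 mul1r => /(_ isT t0 t); rewrite inE eqxx => /(_ isT) /eqP.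
by rewrite oner_eq0.
Qed.

Lemma unit_v : v \is a GRing.unit.
Proof. by have := unit_neq0 (mono_neq0 (1, 0, 0)); rewrite /qmono /= expr1z !mulr1. Qed.

Lemma unit_x : x \is a GRing.unit.
Proof. by have := unit_neq0 (mono_neq0 (0, 1, 0)); rewrite /qmono /= expr1z mulr1 mul1r. Qed.

Lemma unit_y : y \is a GRing.unit.
Proof. by have := unit_neq0 (mono_neq0 (0, 0, 1)); rewrite /qmono /= expr1z !mul1r. Qed.

Lemma commutation : x * y = v ^ 2 * y * x.
Proof. by case: M. Qed.

Lemma mulvzA (k : int) (Y Z : D) : Y * (v ^ k * Z) = v ^ k * (Y * Z).
Proof. by rewrite mulrA -central_vz mulrA. Qed.

Lemma vzD (k l : int) (Y : D) : v ^ k * (v ^ l * Y) = v ^ (k + l) * Y.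
Proof. by rewrite exprzDr ?unit_v // mulrA. Qed.

Lemma commutationX (a b : int) : y ^ b * x ^ a = v ^ (- 2 * b * a) * (x ^ a * y ^ b).
Proof.
have uv := unit_v; have ux := unit_x; have uy := unit_y.
have yx : y * x = x * (v ^ (- 2) * y).
  by rewrite mulvzA commutation -mulrA vzD addNr expr0z mul1r.
have uvz k Y : Y \is a GRing.unit -> v ^ k * Y \is a GRing.unit.
  by move=> uY; rewrite unitrMl ?unitrXz.
have yXx : y ^ b * x = x * (v ^ (- 2 * b) * y ^ b).
  rewrite (semicommXz _ uy (uvz _ _ uy) yx) exprMz_comm ?unitrXz //; last exact: central_vz.
  by rewrite exprz_exp.
have xy' : x * y ^ b = y ^ b * (v ^ (2 * b) * x).
  by rewrite mulvzA yXx mulvzA vzD -mulrDl subrr mul0r expr0z mul1r.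
rewrite (semicommXz a ux (uvz _ _ ux) xy') exprMz_comm ?unitrXz //; last exact: central_vz.
by rewrite exprz_exp mulvzA vzD -mulrDl -mulrDl addNr !mul0r expr0z mul1r.
Qed.

Lemma monoM k a b k' a' b' :
  mon k a b * mon k' a' b' = mon (k + k' - 2 * b * a') (a + a') (b + b').
Proof.
have uv := unit_v; have ux := unit_x; have uy := unit_y.
have -> : k + k' - 2 * b * a' = k + k' + (- 2 * b * a') by lia.
rewrite /qmono /=; move: (- 2 * b * a') (commutationX a' b) => c yx.
rewrite -!mulrA (mulvzA k' (y ^ b)) (mulvzA k' (x ^ a)) vzD.
rewrite [v ^ (_ + c)]exprzDr // -mulrA; congr (_ * _).
by rewrite [y ^ b * _]mulrA yx -!mulrA mulvzA !exprzDr // -!mulrA.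
Qed.

Lemma mono0 : mon 0 0 0 = 1.
Proof. by rewrite /qmono /= !mulr1. Qed.

Lemma mono_v k : v ^ k = mon k 0 0.
Proof. by rewrite /qmono /= !mulr1. Qed.

Lemma mono_x k : x ^ k = mon 0 k 0.
Proof. by rewrite /qmono /= mulr1 mul1r. Qed.

Lemma mono_y k : y ^ k = mon 0 0 k.
Proof. by rewrite /qmono /= !mul1r. Qed.

Lemma monoV k a b : (mon k a b)^-1 = mon (- k - 2 * a * b) (- a) (- b).
Proof.
have u := unit_neq0 (mono_neq0 (k, a, b)); apply: (can_inj (mulKr u)).
rewrite divrr // monoM -mono0; congr (mono (_, _, _)); lia.
Qed.

Lemma laurent0 G : L G 0.
Proof. by exists [::]; rewrite big_nil. Qed.

Lemma laurentW (G G' : pred (int * int)) Y : (forall a b, G (a, b) -> G' (a, b)) -> L G Y -> L G' Y.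
Proof. by move=> sG [s [sG' ->]]; exists s; split=> // t /sG'; apply: sG. Qed.

Lemma laurentD G Y Z : L G Y -> L G Z -> L G (Y + Z).
Proof.
move=> [s [Gs ->]] [r [Gr ->]]; exists (s ++ r); rewrite big_cat; split=> // t.
by rewrite mem_cat => /orP [/Gs|/Gr].
Qed.

Lemma laurent_int G c Y : L G Y -> L G (c%:~R * Y).
Proof.
move=> [s [Gs ->]]; exists [seq (c * t.1, t.2) | t <- s]; split.
  by move=> _ /mapP [t ts ->]; apply: (Gs t).
by rewrite big_map mulr_sumr; apply: eq_bigr => t _; rewrite /= intrM mulrA.
Qed.

Lemma laurentN G Y : L G Y -> L G (- Y).
Proof. by move=> /(laurent_int (-1)); rewrite mulN1r. Qed.

Lemma laurentB G Y Z : L G Y -> L G Z -> L G (Y - Z).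
Proof. by move=> LY LZ; apply/laurentD/laurentN. Qed.

Lemma laurent_subK G Y Z : L G (Y - Z) -> L G Z -> L G Y.
Proof. by move=> hYZ hZ; rewrite -[Y](subrK Z); apply: laurentD. Qed.

Lemma laurent_sum (I : eqType) (r : seq I) (P : pred I) (F : I -> D) G :
  (forall i, i \in r -> P i -> L G (F i)) -> L G (\sum_(i <- r | P i) F i).
Proof.
move=> LF; rewrite big_seq_cond; apply: (big_ind (L G)) => [|Y Z|i /andP[]].
- exact: laurent0.
- exact: laurentD.
- exact: LF.
Qed.

Lemma laurent_mono (G : pred (int * int)) k a b : G (a, b) -> L G (mon k a b).
Proof. by exists [:: (1, (k, a, b))]; rewrite big_seq1 mul1r; split=> // t /[!inE] /eqP ->. Qed.

Lemma laurentM (G1 G2 G : pred (int * int)) Y Z :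
  (forall a b a' b', G1 (a, b) -> G2 (a', b') -> G (a + a', b + b')) ->
  L G1 Y -> L G2 Z -> L G (Y * Z).
Proof.
move=> GG [s [Gs ->]] [r [Gr ->]]; rewrite mulr_suml.
apply: laurent_sum => -[c [[k a] b]] /Gs /= Gt _; rewrite mulr_sumr.
apply: laurent_sum => -[c' [[k' a'] b']] /Gr /= Gt' _.
have -> : c%:~R * mon k a b * (c'%:~R * mon k' a' b') =
    c%:~R * (c'%:~R * (mon k a b * mon k' a' b')).
  move: (mon k a b) (mon k' a' b') => X X'.
  by rewrite -mulrA (mulrA X) (commr_int X c') -(mulrA _ X).
by do 2 apply: laurent_int; rewrite monoM; apply: laurent_mono; apply: GG.
Qed.

Lemma laurent_split G (P : pred (int * int)) Y : L G Y ->
  exists Y1 Y2, [/\ Y = Y1 + Y2, L (predI G P) Y1 & L (predI G (predC P)) Y2].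
Proof.
move=> [s [Gs ->]]; pose Q (t : int * (int * int * int)) := P (t.2.1.2, t.2.2).
exists (\sum_(t <- s | Q t) t.1%:~R * mono t.2), (\sum_(t <- s | ~~ Q t) t.1%:~R * mono t.2).
split; first by rewrite (bigID Q).
  apply: laurent_sum => -[c [[k a] b]] /Gs Gt Qt.
  by apply: laurent_int; apply: laurent_mono; rewrite /= Gt.
apply: laurent_sum => -[c [[k a] b]] /Gs Gt Qt.
by apply: laurent_int; apply: laurent_mono; rewrite /= Gt.
Qed.

(** In the difference of the two expansions a monomial of the first receives nothing from the
    second, so its coefficient vanishes by linear independence. This is the form in which uniqueness
    of Laurent expansions is used. *)
Lemma laurent_disjoint (G1 G2 : pred (int * int)) Y :
  (forall a b, G1 (a, b) -> ~~ G2 (a, b)) -> L G1 Y -> L G2 Y -> Y = 0.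
Proof.
move=> dis [s [Gs Ys]] [r [Gr Yr]].
have key (u : seq (int * (int * int * int))) :
    \sum_(t <- u) t.1%:~R * mono t.2 =
    \sum_(k <- undup [seq t.2 | t <- u])
      (\sum_(t <- u | t.2 == k) t.1)%:~R * (v ^ k.1.1 * x ^ k.1.2 * y ^ k.2).
  rewrite (sum_by_key (fun t => t.2)); apply: eq_bigr => k _.
  by rewrite rmorph_sum mulr_suml; apply: eq_bigr => t /eqP ->.
pose u := s ++ [seq (- t.1, t.2) | t <- r].
have u0 : \sum_(t <- u) t.1%:~R * mono t.2 = 0.
  rewrite big_cat big_map /= -Ys [X in _ + X](_ : _ = - Y) ?subrr //.
  by rewrite Yr -sumrN; apply: eq_bigr => t _; rewrite /= rmorphN mulNr.
case: M => _ _ _ ind; rewrite key in u0.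
have {}ind := ind _ _ (undup_uniq _) u0.
rewrite Ys key big1_seq // => k /andP [_]; rewrite mem_undup => sk.
have {}ind : \sum_(t <- u | t.2 == k) t.1 = 0.
  by apply: ind; rewrite mem_undup map_cat mem_cat sk.
move: ind; rewrite big_cat big_map /= [X in _ + X]big1_seq ?addr0 => [->|]; first by rewrite mul0r.
move=> t /andP [/= /eqP tk rt]; have /mapP [t' st' kt'] := sk.
by have := dis _ _ (Gs _ st'); rewrite -kt' -tk Gr.
Qed.

End Torus.

(** * Leading terms for a weight on exponents *)

Definition wlt (al be w : int) (g : int * int) : bool := al * g.1 + be * g.2 < w.
Arguments wlt _ _ _ _ /.

Definition weq (al be w : int) (g : int * int) : bool := al * g.1 + be * g.2 == w.
Arguments weq _ _ _ _ /.

(** The top layer is one monomial whose coefficient is a power of [v], hence a unit: such leading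
    terms can be multiplied and divided. *)
Definition has_lead (D : unitRingType) (v x y : D) (al be w : int) (Y : D) :=
  exists k a b, al * a + be * b = w /\
    laurent v x y (wlt al be w) (Y - qmono v x y (k, a, b)).

Section Lead.
Variables (D : unitRingType) (v x y : D).
Hypothesis M : qtorus_model v x y.
Variables (al be : int).

Local Notation mono := (qmono v x y).
Local Notation mon k a b := (mono (k, a, b)).
Local Notation L := (laurent v x y).
Local Notation lead := (has_lead v x y al be).
Local Notation wt_lt := (wlt al be).

(** Both bounds are strict and weights are integers, which gains the extra 1. *)
Lemma wt_ltM w1 w2 w Y Z : w1 + w2 <= w + 1 ->
  L (wt_lt w1) Y -> L (wt_lt w2) Z -> L (wt_lt w) (Y * Z).
Proof.
move=> ww; apply: laurentM => // a b a' b' /= h h'.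
by rewrite !mulrDr addrACA; lia.
Qed.

Lemma wt_ltW w w' Y : w <= w' -> L (wt_lt w) Y -> L (wt_lt w') Y.
Proof. by move=> ww; apply: laurentW => a b /= h; apply: lt_le_trans ww. Qed.

Lemma lead_lt w w' Y : w < w' -> lead w Y -> L (wt_lt w') Y.
Proof.
move=> ww [k [a [b [wE LY]]]]; rewrite -[Y](subrK (mon k a b)).
apply: laurentD; first by apply: wt_ltW LY; apply: ltW.
by apply: laurent_mono; rewrite /= wE.
Qed.

Lemma lead_mono k a b : lead (al * a + be * b) (mon k a b).
Proof. by exists k, a, b; split=> //; rewrite subrr; apply: laurent0. Qed.

Lemma lead1 : lead 0 1.
Proof. by have := lead_mono 0 0 0; rewrite mono0 !mulr0. Qed.

Lemma leadDl w Y Z : lead w Y -> L (wt_lt w) Z -> lead w (Y + Z).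
Proof.
by move=> [k [a [b [wE LY]]]] LZ; exists k, a, b; split=> //; rewrite addrAC; apply: laurentD.
Qed.

Lemma leadM w1 w2 Y Z : lead w1 Y -> lead w2 Z -> lead (w1 + w2) (Y * Z).
Proof.
move=> lY lZ; have LZ : L (wt_lt (w2 + 1)) Z by apply: lead_lt lZ; lia.
case: lY lZ => k [a [b [wE LY]]] [k' [a' [b' [wE' LZ']]]].
exists (k + k' - 2 * b * a'), (a + a'), (b + b'); rewrite !mulrDr addrACA wE wE'; split=> //.
rewrite -monoM //; set m := mon k a b; set m' := mon k' a' b'.
rewrite (_ : _ - _ = (Y - m) * Z + m * (Z - m')).
  apply: laurentD; first by apply: wt_ltM LY LZ; lia.
  apply: (@wt_ltM (w1 + 1) w2) => //; first by lia.
  by apply: laurent_mono => /=; lia.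
by rewrite mulrBl mulrBr addrA subrK.
Qed.

Lemma leadX n w Y : lead w Y -> lead (n%:Z * w) (Y ^+ n).
Proof.
move=> lY; elim: n => [|n IHn]; first by rewrite mul0r; apply: lead1.
by rewrite exprS -addn1 addnC PoszD mulrDl mul1r; apply: leadM.
Qed.

Lemma leadV k w Y : lead w Y -> lead w (v ^ k * Y).
Proof.
by move=> /(leadM (lead_mono k 0 0)); rewrite !mulr0 !add0r -mono_v.
Qed.

Lemma laurent_bounded Y : L predT Y -> exists n : nat, L (wt_lt n%:Z) Y.
Proof.
move=> [s [_ ->]]; elim: s => [|[c [[k a] b]] s [n IHn]].
  by exists 0%N; rewrite big_nil; apply: laurent0.
exists (maxn n `|al * a + be * b|.+1); rewrite big_cons; apply: laurentD.
  by apply/laurent_int/laurent_mono => /=; lia.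
by apply: wt_ltW IHn; lia.
Qed.

(** The degree is a valuation. A layer of [Y] above [wB - wA], multiplied by the leading monomial of
    [A], could not be cancelled by anything in [B]; at [wB - wA] the layer must turn the leading
    monomial of [A] into that of [B]. *)
Lemma lead_div wA wB A B Y :
  L predT Y -> lead wA A -> lead wB B -> A * Y = B -> lead (wB - wA) Y.
Proof.
move=> LY lA lB AY.
have [k [a [b [wE LA]]]] := lA.
have [l [a' [b' [wE' LB]]]] := lB.
have cancel Z : mon k a b * Z = 0 -> Z = 0.
  by move=> /(canRL (mulKr (unit_neq0 M (mono_neq0 M _)))); rewrite mulr0.
(* Descending induction: each step removes the layer of weight [W], which is above the expected
   degree. *)
have top n : L (wt_lt (wB - wA + 1 + n%:Z)) Y -> L (wt_lt (wB - wA + 1)) Y.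
  elim: n => [|n IHn]; first by rewrite addr0.
  move=> LYn; apply: IHn; set W := wB - wA + 1 + n%:Z.
  have [Y1 [Y2 [YE LY1 LY2]]] := laurent_split (weq al be W) LYn.
  have {}LY2 : L (wt_lt W) Y2.
    by apply: laurentW LY2 => c d /=; rewrite /W; lia.
  suff Y10 : Y1 = 0 by rewrite YE Y10 add0r.
  apply: cancel; apply: (@laurent_disjoint _ _ _ _ M
    (weq al be (wA + W)) (wt_lt (wA + W))).
  - by move=> c d /= /eqP ->; rewrite ltxx.
  - apply: (@laurentM _ _ _ _ M (pred1 (a, b)) (weq al be W)) .
    + by move=> c d c' d' /= /eqP [-> ->] /eqP; rewrite !mulrDr addrACA wE => ->.
    + by apply: laurent_mono => /=.
    + by apply: laurentW LY1 => c d /= /andP [].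
  - rewrite (_ : _ * _ = B - (A - mon k a b) * Y1 - A * Y2).
      apply: laurentB; first apply: laurentB.
      + by apply: lead_lt lB; rewrite /W; lia.
      + apply: (@wt_ltM wA (W + 1)) => //; first by lia.
        by apply: laurentW LY1 => c d /= /andP []; rewrite /W; lia.
      + apply: (@wt_ltM (wA + 1) W) => //; first by lia.
        by apply: lead_lt lA; lia.
    rewrite -AY YE mulrDr mulrBl opprB; move: (A * Y1) (A * Y2) (_ * Y1) => p q r.
    by rewrite addrAC addrK addrCA subrr addr0.
have [n LYn] := laurent_bounded LY.
have Ltop : L (wt_lt (wB - wA + 1)) Y.
  (* The absolute value keeps the starting bound above [n] when [wB - wA + 1] is negative. *)
  by apply: (top (n + absz (wB - wA + 1)%R)%N); apply: wt_ltW LYn; lia.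
set w := wB - wA in Ltop *.
have [Y1 [Y2 [YE LY1 LY2]]] := laurent_split (weq al be w) Ltop.
have {}LY2 : L (wt_lt w) Y2 by apply: laurentW LY2 => c d /=; lia.
(* Comparison of the layers of weight [wB] on both sides of [A * Y = B]. *)
have Y1E : mon k a b * Y1 - mon l a' b' = 0.
  apply: (@laurent_disjoint _ _ _ _ M
    (weq al be wB) (wt_lt wB)).
  - by move=> c d /= /eqP ->; rewrite ltxx.
  - apply: laurentB; last by apply: laurent_mono => /=; apply/eqP.
    apply: (@laurentM _ _ _ _ M (pred1 (a, b)) (weq al be w)).
    + by move=> c d c' d' /= /eqP [-> ->] /eqP; rewrite !mulrDr addrACA wE => ->; rewrite /w; lia.
    + by apply: laurent_mono => /=.
    + by apply: laurentW LY1 => c d /= /andP [].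
  - rewrite (_ : _ - _ = (B - mon l a' b') - (A - mon k a b) * Y1 - A * Y2).
      apply: laurentB; first apply: laurentB => //.
      + apply: (@wt_ltM wA (w + 1)) => //; first by rewrite /w; lia.
        by apply: laurentW LY1 => c d /= /andP [].
      + apply: (@wt_ltM (wA + 1) w) => //; first by rewrite /w; lia.
        by apply: lead_lt lA; lia.
    rewrite -AY YE mulrDr mulrBl opprB; move: (A * Y1) (A * Y2) (_ * Y1) (mon l a' b') => p q r t.
    by rewrite addrAC (addrAC (p + q)) addrK addrC addrA subrK.
move/subr0_eq/(canRL (mulKr (unit_neq0 M (mono_neq0 M _)))) : Y1E; rewrite monoV // monoM // => Y1E.
rewrite YE Y1E; apply: leadDl => //.
set X := mono _; have -> : w = al * (- a + a') + be * (- b + b') by rewrite /w; lia.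
exact: lead_mono.
Qed.

End Lead.

(** * The opposite torus and mutation *)

Lemma qtorus_sym (D : unitRingType) (v x y : D) :
  qtorus_model v x y -> qtorus_model v^-1 y x.
Proof.
move=> M; have uv := unit_v M; split.
- exact: unit_neq0 M.
- by move=> Y; apply/commr_sym/commrV/commr_sym/(central_v M).
- rewrite -[_ ^+ 2]/(_ ^ 2) exprz_inv -mulrA (commutation M) -mulrA (vzD M).
  by rewrite addNr expr0z mul1r.
move=> s c us s0 t ts.
(* Reordering the two factors of a monomial contributes the power [-2ab] of [v]. *)
pose f (t : int * int * int) := (- t.1.1 - 2 * t.1.2 * t.2, t.2, t.1.2).
have fK : involutive f by case=> [[k a] b]; rewrite /f /=; congr (_, _, _); lia.
have usf : uniq (map f s) by rewrite map_inj_uniq //; apply: inv_inj.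
case: (M) => _ _ _ /(_ (map f s) (c \o f) usf) /= ind.
rewrite -[t]fK; apply: ind; last exact: map_f.
rewrite big_map -[RHS]s0; apply: eq_bigr => -[[k a] b] _; rewrite fK /f /=.
rewrite exprz_inv -[in RHS]mulrA (commutationX M) (vzD M) -[in LHS]mulrA.
by congr (_ * (v ^ _ * _)); lia.
Qed.

Lemma exch_neq0 (D : unitRingType) (v x y : D) n :
  qtorus_model v x y -> (0 < n)%N -> v ^+ n * y ^+ n + 1 != 0.
Proof.
move=> M n0; apply/eqP => e0.
case: M => _ _ _ /(_ [:: (n%:Z, 0, n%:Z); (0, 0, 0)] (fun=> 1)).
rewrite /= inE andbT !xpair_eqE !andbT !big_cons big_nil !mul1r !mulr1 addr0 /=.
move=> /(_ _ e0 (0, 0, 0)) h.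
suff /eqP : (1 : int) = 0 by rewrite oner_eq0.
by apply: h; [lia | rewrite !inE eqxx orbT].
Qed.

Lemma mutation_laurent (D : unitRingType) (v x y w : D) n :
  qtorus_model v x y -> x * w = v ^+ n * y ^+ n + 1 ->
  w = qmono v x y (n%:Z, -1, n%:Z) + qmono v x y (0, -1, 0).
Proof.
move=> M xw; apply: (can_inj (mulKr (unit_x M))); rewrite xw.
rewrite -[X in _ = X * _]expr1z (mono_x v x y) mulrDr !monoM //.
rewrite subrr; congr (_ + _); last by rewrite -(mono0 v x y).
rewrite -[_ ^+ n]/(v ^ n%:Z) -[_ ^+ n]/(y ^ n%:Z) (mono_v v x y) (mono_y v x y).
by rewrite monoM //; congr (qmono _ _ _ (_, _, _)); lia.
Qed.

Lemma exch_swap (D : unitRingType) (v x y w : D) n :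
  qtorus_model v x y -> x * w = v ^+ n * y ^+ n + 1 ->
  w * x = v^-1 ^+ n * y ^+ n + 1.
Proof.
move=> M xw; rewrite (mutation_laurent M xw).
rewrite -[X in _ * X = _]expr1z (mono_x v x y) mulrDl !monoM //.
congr (_ + _); last by rewrite -(mono0 v x y).
rewrite -[_ ^+ n]/(v^-1 ^ n%:Z) -[_ ^+ n]/(y ^ n%:Z) exprz_inv.
by rewrite (mono_v v x y) (mono_y v x y) monoM //; congr (qmono _ _ _ (_, _, _)); lia.
Qed.

(** Both terms of [w] have [x]-exponent -1, so [w ^ m] with [m >= 0] is homogeneous of degree [-m]
    in [x]. In a linear relation the terms with different powers of [w] therefore separate, and what
    remains is a relation between monomials in [v] and [y]. *)
Lemma qtorus_mutation (D : unitRingType) (v x y w : D) n :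
  qtorus_model v x y -> (0 < n)%N -> x * w = v ^+ n * y ^+ n + 1 ->
  qtorus_model v y w.
Proof.
move=> M n0 xw; have wE := mutation_laurent M xw.
have uw : w \is a GRing.unit.
  apply: (unit_neq0 M); apply/eqP => w0; move: xw; rewrite w0 mulr0 => /esym/eqP.
  by apply/negP/(exch_neq0 M).
have Lw (m : nat) : laurent v x y [pred g | g.1 == - m%:Z] (w ^ m%:Z).
  elim: m => [|m IHm]; first by rewrite expr0z -(mono0 v x y); apply: laurent_mono.
  rewrite -exprnP exprSr.
  apply: (@laurentM _ _ _ _ M _ [pred g : int * int | g.1 == -1]) IHm _.
    by move=> a b a' b' /= /eqP -> /eqP ->; lia.
  by rewrite wE; apply: laurentD; apply: laurent_mono.
split.
- exact: unit_neq0 M.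
- exact: central_v M.
- rewrite -mulrA -[v ^+ 2]/(v ^ 2) -(expr1z y) (mono_y v x y) (mono_v v x y) wE.
  rewrite !(mulrDl, mulrDr) !monoM //.
  by congr (qmono _ _ _ (_, _, _) + qmono _ _ _ (_, _, _)); lia.
move=> s c us s0 t0 ts0; set b0 := t0.2.
(* Multiplication by [w ^ N] clears the negative powers of [w], which need not be Laurent
   polynomials in [x] and [y]. *)
have [N NP] : exists N : nat, forall t, t \in s -> 0 <= t.2 + N%:Z.
  elim: s {us s0 ts0} => [|t s [N NP]]; first by exists 0%N.
  exists (N + absz t.2)%N => t' /[!inE] /predU1P [->|/NP]; rewrite PoszD; move: t.2 => b; lia.
pose F (t : int * int * int) := (c t)%:~R * (v ^ t.1.1 * y ^ t.1.2).
have LF (P : pred int) :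
    laurent v x y [pred g : int * int | P (- g.1 - N%:Z)]
      (\sum_(t <- s | P t.2) F t * w ^ (t.2 + N%:Z)).
  apply: laurent_sum => t st Pt; rewrite /F -mulrA; apply: laurent_int.
  have := NP _ st; case E: (t.2 + N%:Z) => [m|//] _.
  apply: (@laurentM _ _ _ _ M [pred g | g.1 == 0]) (Lw m) => [a b a' b' /= /eqP -> /eqP ->|].
    by rewrite add0r opprK -E addrK.
  rewrite (mono_y v x y) (mono_v v x y) monoM //.
  by apply: laurent_mono.
have split0 : \sum_(t <- s | t.2 == b0) F t * w ^ (t.2 + N%:Z) +
              \sum_(t <- s | t.2 != b0) F t * w ^ (t.2 + N%:Z) = 0.
  rewrite -[RHS](mul0r (w ^ N%:Z)) -[X in _ = X * _]s0 mulr_suml [RHS](bigID (fun t => t.2 == b0)) /=.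
  by congr (_ + _); apply: eq_bigr => t _; rewrite exprzDr // /F !mulrA.
have Fb0 : (\sum_(t <- s | t.2 == b0) F t) * w ^ (b0 + N%:Z) = 0.
  have <- : \sum_(t <- s | t.2 == b0) F t * w ^ (t.2 + N%:Z) =
      (\sum_(t <- s | t.2 == b0) F t) * w ^ (b0 + N%:Z).
    by rewrite mulr_suml; apply: eq_bigr => t /eqP ->.
  apply: (laurent_disjoint M) (LF (pred1 b0)) _; last first.
    move/eqP: split0; rewrite addr_eq0 => /eqP ->; apply: laurentN.
    exact: (LF (predC (pred1 b0))).
  by move=> a b /= /eqP ->; rewrite eqxx.
have {}Fb0 : \sum_(t <- s | t.2 == b0) F t = 0.
  by move: Fb0 => /(canRL (mulrK (unitrXz _ uw))); rewrite mul0r.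
case: (M) => _ _ _ ind.
pose f (t : int * int * int) := (t.1.1, 0 : int, t.1.2).
pose s' := map f [seq t <- s | t.2 == b0].
have := ind s' (fun t => c (t.1.1, t.2, b0)).
have us' : uniq s'.
  rewrite map_inj_in_uniq ?filter_uniq // => -[[k a] b] [[k' a'] b'].
  by rewrite !mem_filter /= => /andP[/eqP -> _] /andP[/eqP -> _] [-> ->].
move=> /(_ us') /=; rewrite big_map big_filter => {}ind.
have -> : c t0 = c ((f t0).1.1, (f t0).2, b0) by rewrite /f /b0 /=; case: (t0) => [[]].
apply: ind; last by apply: map_f; rewrite mem_filter eqxx.
rewrite -[RHS]Fb0; apply: eq_bigr => -[[k a] b] /= /eqP ->.
by rewrite /F /= mulr1.
Qed.

(** The solution [P0] of the reversed relation satisfies the given one, by [exch_swap] in the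
    opposite torus; cancelling [y] identifies it with [P]. *)
Lemma exch_swapV (D : unitRingType) (v x y P : D) n :
  qtorus_model v x y -> P * y = v ^+ n * x ^+ n + 1 ->
  y * P = v^-1 ^+ n * x ^+ n + 1.
Proof.
move=> M Py; have uy := unit_y M.
pose P0 := y^-1 * (v^-1 ^+ n * x ^+ n + 1).
have yP0 : y * P0 = v^-1 ^+ n * x ^+ n + 1 by rewrite mulVKr.
by have := exch_swap (qtorus_sym M) yP0; rewrite invrK -Py => /(mulIr uy) <-.
Qed.

(** * [X_delta] in five consecutive cluster variables [P, x, y, w, Q], with [x] of odd index *)

Section Delta.
Variables (D : unitRingType) (v x y P w Q : D).
Hypothesis M : qtorus_model v x y.
Hypothesis PE : P * y = v * x + 1.
Hypothesis wE : x * w = v ^+ 4 * y ^+ 4 + 1.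
Hypothesis QE : y * Q = v * w + 1.

Local Notation mon k a b := (qmono v x y (k, a, b)).
Local Notation z := (Xdelta v x y).

Lemma v_mon l k a b : v ^ l * mon k a b = mon (l + k) a b.
Proof. by rewrite /qmono /= -!mulrA (vzD M). Qed.

Lemma v1_mon k a b : v * mon k a b = mon (1 + k) a b.
Proof. by rewrite -v_mon expr1z. Qed.

Lemma vV_mon k a b : v^-1 * mon k a b = mon (-1 + k) a b.
Proof. by rewrite -v_mon. Qed.

Lemma mon_y k a b : mon k a b * y = mon k a (b + 1).
Proof. by rewrite /qmono /= -mulrA exprzDr ?(unit_y M). Qed.

Lemma x_mon k a b : x * mon k a b = mon k (1 + a) b.
Proof. by rewrite /qmono /= exprzDr ?(unit_x M) // expr1z !mulrA (central_vz M). Qed.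

Lemma y_mon k a b : y * mon k a b = mon (k - 2 * a) a (1 + b).
Proof.
rewrite -{1}(expr1z y) (mono_y v x y).
by rewrite monoM //; congr (qmono _ _ _ (_, _, _)); lia.
Qed.

Lemma prev_laurent : P = mon 1 1 (-1) + mon 0 0 (-1).
Proof.
apply: (mulIr (unit_y M)); rewrite PE mulrDl !mon_y.
by rewrite mono0 /qmono /= mulr1 !expr1z.
Qed.

Lemma next_laurent : Q = mon 3 (-1) 3 + mon (-1) (-1) (-1) + mon 0 0 (-1).
Proof.
have w2 : w = mon 4 (-1) 4 + mon 0 (-1) 0 by apply: mutation_laurent.
apply: (can_inj (mulKr (unit_y M))); rewrite QE w2 !mulrDr !y_mon mono0.
by rewrite !v1_mon.
Qed.

Lemma delta_laurent : z = mon 2 (-1) 2 + mon 2 1 (-2) +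
  (mon (-2) (-1) (-2) + (mon (-1) 0 (-2) + mon 1 0 (-2))).
Proof.
have XabE a b : Xab v x y a b = mon (- (a * b)) a b by [].
rewrite /Xdelta mulrDl !XabE !v1_mon !vV_mon !addrA.
by rewrite [LHS](ACl (2 * 3 * 1 * 4 * 5)).
Qed.

Lemma x_delta : x * z = v ^ (-2) * P ^+ 2 + v ^ 2 * y ^+ 2.
Proof.
rewrite delta_laurent prev_laurent expr2 !(mulrDl, mulrDr) !monoM // !v_mon !x_mon.
rewrite -[y ^+ 2]/(y ^ 2) (mono_y v x y) !v_mon !addrA.
by rewrite [LHS](ACl (2 * 4 * 5 * 3 * 1)).
Qed.

Lemma delta_y : z * y = v * P + v^-1 * Q.
Proof.
rewrite delta_laurent prev_laurent next_laurent !mulrDl !mulrDr !mon_y.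
rewrite !v1_mon !vV_mon !addrA.
by rewrite [LHS](ACl (2 * 5 * 1 * 3 * 4)).
Qed.

Lemma y_delta : y * z = v^-1 * P + v * Q.
Proof.
rewrite delta_laurent prev_laurent next_laurent !mulrDr !y_mon.
rewrite !v1_mon !vV_mon !addrA.
by rewrite [LHS](ACl (2 * 4 * 1 * 3 * 5)).
Qed.

End Delta.

(** The formula for [x * z] in [x_delta] is symmetric under exchanging [P] with [y] and [v] with its
    inverse. *)
Lemma delta_mutation_y (D : unitRingType) (v x y P : D) :
  qtorus_model v x y -> P * y = v * x + 1 -> Xdelta v x y = Xdelta v^-1 x P.
Proof.
move=> M PE; have yP := exch_swapV (n := 1) M PE.
have M' := qtorus_mutation (qtorus_sym M) (n := 1) isT yP.
apply: (can_inj (mulKr (unit_x M))); rewrite (x_delta M PE) (x_delta M' yP).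
by rewrite !exprz_inv opprK addrC.
Qed.

(** The formula for [z * y] in [delta_y] is symmetric under exchanging [P] with [Q] and [v] with its
    inverse. *)
Lemma delta_mutation_x (D : unitRingType) (v x y w : D) :
  qtorus_model v x y -> x * w = v ^+ 4 * y ^+ 4 + 1 ->
  Xdelta v x y = Xdelta v^-1 w y.
Proof.
move=> M wE; have uy := unit_y M.
have My := qtorus_mutation (n := 4) M isT wE; have M' := qtorus_sym My.
pose P := (v * x + 1) * y^-1; have PE : P * y = v * x + 1 by rewrite mulrVK.
pose Q := y^-1 * (v * w + 1); have QE : y * Q = v * w + 1 by rewrite mulVKr.
have Qy := exch_swap (n := 1) My QE.
have wx := exch_swap (n := 4) M wE.
have yP := exch_swapV (n := 1) M PE.
apply: (mulIr uy); rewrite (delta_y M PE wE QE) (delta_y M' Qy wx yP).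
by rewrite invrK addrC.
Qed.

(** * Cluster variables and exchange relations *)

Definition expo (k : int) : nat := if odd `|k|%N then 1%N else 4%N.

Lemma exchE (D : unitRingType) (v y : D) b :
  exch v b y = v ^+ (if b then 1%N else 4%N) * y ^+ (if b then 1%N else 4%N) + 1.
Proof. by case: b. Qed.

Section ClusterVariables.
Variables (D : unitRingType) (v x1 x2 : D).
Hypothesis M : qtorus_model v x1 x2.

Local Notation X := (clvar v x1 x2).
Local Notation z := (Xdelta v x1 x2).
Local Notation E i := (X (2 * i)).
Local Notation O i := (X (2 * i + 1)).

Lemma clfwdE n : clfwd v x1 x2 n = (X (n%:Z + 1), X (n%:Z + 2)).
Proof. by rewrite -!PoszD addn1 addn2 /=; case: (clfwd _ _ _ n). Qed.

Lemma clbwdE n : clbwd v x1 x2 n = (X (1 - n%:Z), X (2 - n%:Z)).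
Proof.
have fstE m : (clbwd v x1 x2 m).1 = X (1 - m%:Z).
  case: m => [|[|m]] //; have -> : 1 - m.+2%:Z = Negz m by lia.
  by [].
rewrite [LHS]surjective_pairing fstE; congr (_, _).
case: n => [|n] //; have -> : 2 - n.+1%:Z = 1 - n%:Z by lia.
by rewrite -fstE.
Qed.

(** The division defining the next variable is legitimate because the current pair generates a
    torus, and the resulting relation makes the next pair a torus by mutation. *)
Lemma fwd_step n : qtorus_model v (X (n%:Z + 1)) (X (n%:Z + 2)) /\
  X (n%:Z + 1) * X (n%:Z + 3) = exch v (odd n) (X (n%:Z + 2)).
Proof.
have rel m : qtorus_model v (X (m%:Z + 1)) (X (m%:Z + 2)) ->
    X (m%:Z + 1) * X (m%:Z + 3) = exch v (odd m) (X (m%:Z + 2)).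
  move=> Mm; have -> : m%:Z + 3 = m.+1%:Z + 2 by lia.
  rewrite (_ : X (m.+1%:Z + 2) = (clfwd v x1 x2 m.+1).2); last by rewrite clfwdE.
  rewrite -[snd _]/((clfwd v x1 x2 m).1^-1 * exch v (odd m) (clfwd v x1 x2 m).2).
  by rewrite clfwdE mulVKr // (unit_x Mm).
suff Mn : qtorus_model v (X (n%:Z + 1)) (X (n%:Z + 2)) by split=> //; apply: rel.
elim: n => [|n IHn] //; have := rel n IHn; rewrite exchE => /(qtorus_mutation IHn).
have -> : n.+1%:Z + 1 = n%:Z + 2 by lia.
have -> : n.+1%:Z + 2 = n%:Z + 3 by lia.
by apply; case: odd.
Qed.

Lemma bwd_step n : qtorus_model v (X (1 - n%:Z)) (X (2 - n%:Z)) /\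
  X (- n%:Z) * X (2 - n%:Z) = exch v (~~ odd n) (X (1 - n%:Z)).
Proof.
have rel m : qtorus_model v (X (1 - m%:Z)) (X (2 - m%:Z)) ->
    X (- m%:Z) * X (2 - m%:Z) = exch v (~~ odd m) (X (1 - m%:Z)).
  move=> Mm; have mE : - m%:Z = 1 - m.+1%:Z by lia.
  rewrite (_ : X (- m%:Z) = (clbwd v x1 x2 m.+1).1); last by rewrite mE clbwdE.
  rewrite -[fst _]/(exch v (~~ odd m) (clbwd v x1 x2 m).1 * (clbwd v x1 x2 m).2^-1).
  by rewrite clbwdE mulrVK // (unit_y Mm).
suff Mn : qtorus_model v (X (1 - n%:Z)) (X (2 - n%:Z)) by split=> //; apply: rel.
elim: n => [|n IHn] //; have := rel n IHn.
(* A backward mutation is a forward one in the opposite torus. *)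
rewrite exchE => /(exch_swapV IHn) /(qtorus_mutation (qtorus_sym IHn)) h.
have -> : 2 - n.+1%:Z = 1 - n%:Z by lia.
have -> : 1 - n.+1%:Z = - n%:Z by lia.
have {}h : qtorus_model v^-1 (X (1 - n%:Z)) (X (- n%:Z)) by apply: h; case: odd.
by have := qtorus_sym h; rewrite invrK.
Qed.

Lemma cl_model k : qtorus_model v (X k) (X (k + 1)).
Proof.
have [k0|k0] := leP 1 k.
  have [+ _] := fwd_step `|k - 1|.
  by congr (qtorus_model _ (X _) (X _)); lia.
have [+ _] := bwd_step `|1 - k|.
by congr (qtorus_model _ (X _) (X _)); lia.
Qed.

Lemma cl_exch k : X (k - 1) * X (k + 1) = v ^+ expo k * X k ^+ expo k + 1.
Proof.
have [k0|k0] := leP 2 k.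
  have [_ ] := fwd_step `|k - 2|; rewrite exchE.
  have -> : (if odd `|k - 2| then 1%N else 4%N) = expo k.
    by rewrite /expo; congr (if _ then _ else _); lia.
  have -> : `|k - 2|%N%:Z + 1 = k - 1 by lia.
  have -> : `|k - 2|%N%:Z + 3 = k + 1 by lia.
  by have -> : `|k - 2|%N%:Z + 2 = k by lia.
have [_ ] := bwd_step `|1 - k|; rewrite exchE.
have -> : (if ~~ odd `|1 - k| then 1%N else 4%N) = expo k.
    by rewrite /expo; congr (if _ then _ else _); lia.
have -> : 2 - `|1 - k|%N%:Z = k + 1 by lia.
have -> : 1 - `|1 - k|%N%:Z = k by lia.
by have -> : - `|1 - k|%N%:Z = k - 1 by lia.
Qed.

Lemma cl_exchV k : X (k + 1) * X (k - 1) = v^-1 ^+ expo k * X k ^+ expo k + 1.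
Proof.
by apply: exch_swap (cl_exch k); have := cl_model (k - 1); rewrite subrK.
Qed.

Lemma unit_cl k : X k \is a GRing.unit.
Proof. exact: unit_x (cl_model k). Qed.

(** * The even and odd cluster variables and [X_delta] *)

Lemma model_EO i : qtorus_model v (E i) (O i).
Proof. exact: cl_model. Qed.

Lemma model_OE i : qtorus_model v (O i) (E (i + 1)).
Proof. by have := cl_model (2 * i + 1); rewrite mulrDr -addrA. Qed.

Lemma exch_EE i : E i * E (i + 1) = v * O i + 1.
Proof.
have := cl_exch (2 * i + 1); rewrite addrK /expo mulrDr -addrA.
by have -> : odd `|2 * i + 1| by lia.
Qed.

Lemma exch_EEV i : E (i + 1) * E i = v^-1 * O i + 1.
Proof.
have := cl_exchV (2 * i + 1); rewrite addrK /expo mulrDr -addrA.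
by have -> : odd `|2 * i + 1| by lia.
Qed.

Lemma exch_OO i : O i * O (i + 1) = v ^+ 4 * E (i + 1) ^+ 4 + 1.
Proof.
have := cl_exch (2 * (i + 1)); rewrite /expo.
have -> : odd `|2 * (i + 1)| = false by lia.
by have -> : 2 * (i + 1) - 1 = 2 * i + 1 by lia.
Qed.

(** Passing from one odd cluster to the next takes two mutations, each of which inverts [v] in the
    formula for [X_delta]. *)
Lemma delta_cl i : Xdelta v (O i) (E (i + 1)) = z.
Proof.
have -> : z = Xdelta v (O 0) (E (0 + 1)) by [].
move: i; apply: (@int_shift_const _ (fun i => Xdelta v (O i) (E (i + 1)))) => i.
rewrite (delta_mutation_x (model_OE i) (exch_OO i)).
by rewrite (delta_mutation_y (model_OE (i + 1)) (exch_EE (i + 1))).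
Qed.

Lemma delta_clV i : Xdelta v^-1 (O i) (E i) = z.
Proof. by rewrite -(delta_cl i) (delta_mutation_y (model_OE i) (exch_EE i)). Qed.

Lemma delta_E i : z * E (i + 1) = v * E i + v^-1 * E (i + 2).
Proof.
have := exch_EE (i + 1); rewrite -addrA => h.
by have := delta_y (model_OE i) (exch_EE i) (exch_OO i) h; rewrite delta_cl.
Qed.

Lemma E_delta i : E (i + 1) * z = v^-1 * E i + v * E (i + 2).
Proof.
have := exch_EE (i + 1); rewrite -addrA => h.
by have := y_delta (model_OE i) (exch_EE i) (exch_OO i) h; rewrite delta_cl.
Qed.

Lemma O_delta i : O i * z = v ^ (-2) * E i ^+ 2 + v ^ 2 * E (i + 1) ^+ 2.
Proof. by have := x_delta (model_OE i) (exch_EE i); rewrite delta_cl. Qed.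

(** * Spans over the Laurent polynomials in [v] *)

Inductive vspan (P : D -> Prop) : D -> Prop :=
  | vspan_gen Y : P Y -> vspan P Y
  | vspan0 : vspan P 0
  | vspanD Y Z : vspan P Y -> vspan P Z -> vspan P (Y + Z)
  | vspanN Y : vspan P Y -> vspan P (- Y)
  | vspanV k Y : vspan P Y -> vspan P (v ^ k * Y).

Lemma vspanB P Y Z : vspan P Y -> vspan P Z -> vspan P (Y - Z).
Proof. by move=> hY hZ; apply/vspanD/vspanN. Qed.

Lemma vspanVE P k Y : vspan P (v ^ k * Y) -> vspan P Y.
Proof. by move=> /(vspanV (- k)); rewrite (vzD M) addNr expr0z mul1r. Qed.

Lemma vspan_mono (P Q : D -> Prop) Y :
  (forall Z, P Z -> vspan Q Z) -> vspan P Y -> vspan Q Y.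
Proof.
move=> PQ; elim=> {Y} [Y /PQ //||Y Z _ ? _ ?|Y _ ?|k Y _ ?].
- exact: vspan0.
- exact: vspanD.
- exact: vspanN.
- exact: vspanV.
Qed.

Lemma vspan_mulr (P Q : D -> Prop) Y Z :
  (forall T, P T -> vspan Q (T * Z)) -> vspan P Y -> vspan Q (Y * Z).
Proof.
move=> PQ; elim=> {Y} [Y /PQ //||Y T _ ? _ ?|Y _ ?|k Y _ ?].
- by rewrite mul0r; apply: vspan0.
- by rewrite mulrDl; apply: vspanD.
- by rewrite mulNr; apply: vspanN.
- by rewrite -mulrA; apply: vspanV.
Qed.

Lemma vspan_mull (P Q : D -> Prop) Y Z :
  (forall T, P T -> vspan Q (Z * T)) -> vspan P Y -> vspan Q (Z * Y).
Proof.
move=> PQ; elim=> {Y} [Y /PQ //||Y T _ ? _ ?|Y _ ?|k Y _ ?].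
- by rewrite mulr0; apply: vspan0.
- by rewrite mulrDr; apply: vspanD.
- by rewrite mulrN; apply: vspanN.
- by rewrite (mulvzA M); apply: vspanV.
Qed.

Lemma vspan_lpval P Y : vspan P Y ->
  exists l : seq (seq (int * int) * D),
    (forall t, t \in l -> P t.2) /\ Y = \sum_(t <- l) lpval v t.1 * t.2.
Proof.
elim=> {Y} [Y PY||Y Z _ [l [Pl ->]] _ [l' [Pl' ->]]|Y _ [l [Pl ->]]|k Y _ [l [Pl ->]]].
- exists [:: ([:: (1, 0)], Y)]; rewrite big_seq1 /lpval big_seq1 mulr1 mul1r.
  by split=> // t /[!inE] /eqP ->.
- by exists [::]; rewrite big_nil.
- exists (l ++ l'); rewrite big_cat; split=> // t.
  by rewrite mem_cat => /orP [/Pl|/Pl'].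
- exists [seq ([seq (- u.1, u.2) | u <- t.1], t.2) | t <- l]; split.
    by move=> _ /mapP [t /Pl Pt ->].
  rewrite big_map -sumrN; apply: eq_bigr => t _ /=; rewrite -mulNr; congr (_ * _).
  by rewrite /lpval big_map -sumrN; apply: eq_bigr => u _ /=; rewrite rmorphN mulNr.
- exists [seq ([seq (u.1, k + u.2) | u <- t.1], t.2) | t <- l]; split.
    by move=> _ /mapP [t /Pl Pt ->].
  rewrite big_map mulr_sumr; apply: eq_bigr => t _ /=; rewrite mulrA; congr (_ * _).
  rewrite /lpval big_map mulr_sumr; apply: eq_bigr => u _ /=.
  by rewrite (mulrA (v ^ k)) (central_vz M) -mulrA exprzDr // (unit_v M).
Qed.

(** * Quadratic relations between the [E_i] modulo polynomials in [z] *)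

Definition zpow (Y : D) : Prop := exists n : nat, Y = z ^+ n.

Lemma zpow_z Y : vspan zpow Y -> vspan zpow (Y * z).
Proof.
by apply: vspan_mulr => _ [n ->]; apply: vspan_gen; exists n.+1; rewrite exprSr.
Qed.

Lemma delta_Ez i : z * E i = v ^ 1 * E (i - 1) + v ^ (-1) * E (i + 1).
Proof.
have := delta_E (i - 1); rewrite subrK.
by have -> : i - 1 + 2 = i + 1 by lia.
Qed.

Lemma E_deltaz i : E i * z = v ^ (-1) * E (i - 1) + v ^ 1 * E (i + 1).
Proof.
have := E_delta (i - 1); rewrite subrK.
by have -> : i - 1 + 2 = i + 1 by lia.
Qed.

(* [E_i E_{j+1}] and [v^2 E_{i+1} E_j] differ by a polynomial in [z] alone:
   this is what makes a product of [E]'s depend, up to shorter products, only on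
   the sum of its indices. *)
Definition defect i j : D := E i * E (j + 1) - v ^ 2 * (E (i + 1) * E j).

Lemma defect_diag i : defect i i = 1 - v ^ 2.
Proof.
rewrite /defect exch_EE exch_EEV mulrDr mulr1.
have -> : v ^ 2 * (v^-1 * O i) = v * O i by rewrite -[v^-1]/(v ^ (-1)) (vzD M).
by rewrite opprD addrA (addrAC (v * O i)) subrr add0r.
Qed.

(** The product [E_i E_{i+1} z] is computed in two ways: by expanding [E_{i+1} z], and by replacing
    [E_i E_{i+1}] with [v O_i + 1]. *)
Lemma defect_next i : defect i (i + 1) = v ^ (-1) * z.
Proof.
have uv1 := unitrXz 1 (unit_v M).
have h1 : E i * (E (i + 1) * z) =
    v ^ (-1) * (E i * E i) + v ^ 1 * (E i * E (i + 1 + 1)).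
  by rewrite E_deltaz addrK mulrDr !(mulvzA M).
have h2 : E i * (E (i + 1) * z) =
    v ^ (-1) * (E i * E i) + (v ^ 3 * (E (i + 1) * E (i + 1)) + z).
  rewrite mulrA exch_EE mulrDl mul1r [RHS]addrA; congr (_ + z).
  have -> : v * O i * z = v ^ 1 * (O i * z) by rewrite expr1z mulrA.
  by rewrite O_delta -!expr2 mulrDr !(vzD M).
move: h1; rewrite h2 => /addrI h; apply: (can_inj (mulKr uv1)).
by rewrite /defect mulrBr !(vzD M) -h addrAC subrr add0r expr0z mul1r.
Qed.

Lemma defect_z i j :
  defect i j * z = v ^ (-1) * defect i (j - 1) + v ^ 1 * defect i (j + 1).
Proof.
have EEz a b : E a * E b * z = v ^ (-1) * (E a * E (b - 1)) + v ^ 1 * (E a * E (b + 1)).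
  by rewrite -mulrA E_deltaz mulrDr !(mulvzA M).
rewrite /defect mulrBl -[v ^ 2 * _ * z]mulrA !EEz !(mulrBr (v ^ _)) (mulrDr (v ^ 2)) !(vzD M).
by rewrite addrK subrK opprD addrACA.
Qed.

(** By [defect_z] the defects satisfy a three-term recursion in [j], which runs in both directions
    from the values at [j = i] and [j = i + 1]. *)
Lemma defect_zpow i j : vspan zpow (defect i j).
Proof.
suff: vspan zpow (defect i (i + (j - i))) /\ vspan zpow (defect i (i + (j - i) + 1)).
  by rewrite addrCA subrr addr0 => -[].
have up n : vspan zpow (defect i (n - 1)) -> vspan zpow (defect i n) ->
    vspan zpow (defect i (n + 1)).
  move=> h1 h2; apply: (@vspanVE _ 1).
  rewrite (_ : _ * _ = defect i n * z - v ^ (-1) * defect i (n - 1)).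
    by apply: vspanB; [apply: zpow_z | apply: vspanV].
  by rewrite defect_z addrAC subrr add0r.
have down n : vspan zpow (defect i n) -> vspan zpow (defect i (n + 1)) ->
    vspan zpow (defect i (n - 1)).
  move=> h1 h2; apply: (@vspanVE _ (-1)).
  rewrite (_ : _ * _ = defect i n * z - v ^ 1 * defect i (n + 1)).
    by apply: vspanB; [apply: zpow_z | apply: vspanV].
  by rewrite defect_z addrK.
elim/int_rect: (j - i) => [|n [h1 h2]|n [h1 h2]].
- rewrite addr0 defect_diag defect_next; split; last first.
    by apply/vspanV/vspan_gen; exists 1%N.
  have one : vspan zpow 1 by apply: vspan_gen; exists 0%N.
  by rewrite -[v ^ 2]mulr1; apply: vspanB => //; apply: vspanV.
- have -> : i + n.+1%:Z = i + n%:Z + 1 by lia.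
  by split=> //; apply: up => //; rewrite addrK.
- have -> : i - n.+1%:Z + 1 = i - n%:Z by lia.
  split=> //; have -> : i - n.+1%:Z = i - n%:Z - 1 by lia.
  exact: down.
Qed.

(** * Straightening products of the [E_i] *)

Definition Eprod (s : seq int) : D := \prod_(i <- s) E i.

Definition Eprods d (Y : D) : Prop := exists2 s, size s = d & Y = Eprod s.

Lemma Eprod_cons i s : Eprod (i :: s) = E i * Eprod s.
Proof. exact: big_cons. Qed.

Lemma Eprod_cat s t : Eprod (s ++ t) = Eprod s * Eprod t.
Proof. exact: big_cat. Qed.

(** Each factor [z] is absorbed by the first [E], whose index moves by one in either direction; the
    length of the product does not change. *)
Lemma zpow_Eprod d n Y : Eprods d.+1 Y -> vspan (Eprods d.+1) (z ^+ n * Y).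
Proof.
move=> hY; elim: n => [|n IHn]; first by rewrite mul1r; apply: vspan_gen.
rewrite exprS -mulrA; apply: vspan_mull IHn => _ [[|i s] // [ss] ->].
rewrite Eprod_cons mulrA delta_Ez mulrDl -!(mulrA (v ^ _)) -!Eprod_cons.
by apply: vspanD; apply/vspanV/vspan_gen; [exists (i - 1 :: s)|exists (i + 1 :: s)]; rewrite //= ss.
Qed.

Lemma E_zpow i n : vspan (Eprods 1) (E i * z ^+ n).
Proof.
elim: n i => [|n IHn] i.
  by rewrite mulr1; apply: vspan_gen; exists [:: i]; rewrite // /Eprod big_seq1.
rewrite exprS mulrA E_deltaz mulrDl -!(mulrA (v ^ _)).
by apply: vspanD; apply/vspanV.
Qed.

(** Telescoping: one unit of index moved from the right factor to the left one costs [v ^ 2] and a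
    defect. *)
Lemma transfer i j m : vspan zpow (E i * E j - v ^ (2 * m) * (E (i + m) * E (j - m))).
Proof.
have step k a b : vspan zpow (v ^ k * (E a * E b) - v ^ (k + 2) * (E (a + 1) * E (b - 1))).
  have := vspanV k (defect_zpow a (b - 1)).
  by rewrite /defect subrK (mulrBr (v ^ k)) (vzD M).
elim/int_rect: m => [|n IHn|n IHn].
- by rewrite mulr0 expr0z mul1r subr0 addr0 subrr; apply: vspan0.
- rewrite -(subrKA (v ^ (2 * n%:Z) * (E (i + n%:Z) * E (j - n%:Z)))).
  apply: vspanD IHn _; have := step (2 * n%:Z) (i + n%:Z) (j - n%:Z).
  by congr (vspan _ (_ - v ^ _ * (X _ * X _))); lia.
- rewrite -(subrKA (v ^ (2 * - n%:Z) * (E (i - n%:Z) * E (j - - n%:Z)))).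
  apply: vspanD IHn _; rewrite -opprB; apply: vspanN.
  have := step (2 * - n.+1%:Z) (i - n.+1%:Z) (j - - n.+1%:Z).
  by congr (vspan _ (_ - v ^ _ * (X _ * X _))); lia.
Qed.

(** Every power of [z] counts as lower, because a transfer inside a product of two factors leaves a
    polynomial in [z]. *)
Definition lower d (Y : D) : Prop :=
  (exists2 s, (size s < d)%N & Y = Eprod s) \/ zpow Y.

(** The first index is changed from [i] to [i'] at the expense of the second, which keeps the sum;
    the tails are then treated by induction. The error of the transfer has lost two factors, and a
    polynomial in [z] beside the other factors is absorbed by them. *)
Lemma Eprod_balance s t : size s = size t -> \sum_(i <- s) i = \sum_(i <- t) i ->
  exists k, vspan (lower (size s)) (Eprod s - v ^ k * Eprod t).
Proof.
have [n] := ubnP (size s); elim: n s t => // n IHn [|i [|j s]] [|i' t] //= ltn sz.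
- by exists 0; rewrite expr0z mul1r subrr; apply: vspan0.
- case: t sz => // _; rewrite !big_seq1 => ->.
  by exists 0; rewrite expr0z mul1r subrr; apply: vspan0.
case: sz => sz; rewrite !big_cons => sum_eq.
pose j' := j - (i' - i).
have [|//||k hk] := IHn (j' :: s) t; first by move: ltn => /=; lia.
  by rewrite big_cons /j'; move: sum_eq; set a := \sum_(_ <- _) _; set b := \sum_(_ <- _) _; lia.
exists (2 * (i' - i) + k).
rewrite (_ : _ - _ = (E i * E j - v ^ (2 * (i' - i)) * (E i' * E j')) * Eprod s +
    v ^ (2 * (i' - i)) * (E i' * (Eprod (j' :: s) - v ^ k * Eprod t))); last first.
  rewrite mulrBl (mulrBr (E i')) (mulrBr (v ^ _)) (mulvzA M) (vzD M) !Eprod_cons.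
  by rewrite -!(mulrA (v ^ _)) -!(mulrA (E _)) subrKA.
apply: vspanD.
  have := transfer i j (i' - i); rewrite addrCA subrr addr0 -/j'.
  apply: vspan_mulr => _ [m ->].
  case: s {sum_eq hk ltn sz} => [|l s].
    by apply: vspan_gen; right; exists m; rewrite /Eprod big_nil mulr1.
  have /(zpow_Eprod m) : Eprods (size s).+1 (Eprod (l :: s)) by exists (l :: s).
  apply: vspan_mono => _ [u su ->]; apply: vspan_gen; left; exists u => //=.
  by rewrite su.
apply: vspanV; apply: vspan_mull hk => _ [[u su ->]|[m ->]].
  by apply: vspan_gen; left; exists (i' :: u); rewrite ?Eprod_cons.
apply: vspan_mono (E_zpow i' m) => _ [u su ->]; apply: vspan_gen; left; exists u => //.
by rewrite su.
Qed.

Definition Esorted (Y : D) : Prop :=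
  (exists i (a b : nat), Y = E i ^+ a * E (i + 1) ^+ b) \/ zpow Y.

Lemma Eprod_nseq n i : Eprod (nseq n i) = E i ^+ n.
Proof. by rewrite /Eprod big_nseq; elim: n => //= n ->; rewrite exprS. Qed.

Lemma sum_nseq_int n (i : int) : \sum_(j <- nseq n i) j = i * n%:Z.
Proof. by rewrite big_nseq; elim: n => [|n] /=; rewrite ?mulr0 // => ->; lia. Qed.

(** Dividing the sum of the indices by their number gives a quotient [q] and a remainder [r]: the
    balanced product has [d - r] indices [q] and [r] indices [q + 1]. The shorter products in the
    error are handled by induction. *)
Lemma Eprod_sorted s : vspan Esorted (Eprod s).
Proof.
have [n] := ubnP (size s); elim: n s => // n IHn s ltn.
have [/nilP ->|s0] := boolP (nilp s).
  by apply: vspan_gen; right; exists 0%N; rewrite /Eprod big_nil.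
set d := size s in s0; set sg := \sum_(i <- s) i.
pose q := divz sg d%:Z; pose r := `|modz sg d%:Z|%N.
have d0 : 0 < d%:Z by rewrite /nilp -/d in s0; lia.
have rE : r%:Z = modz sg d%:Z by rewrite /r gez0_abs // modz_ge0 // gt_eqF.
have rd : (r < d)%N by rewrite -ltz_nat rE ltz_pmod.
have sgE : sg = q * d%:Z + r%:Z by rewrite rE -divz_eq.
pose t := nseq (d - r) q ++ nseq r (q + 1).
have [||k hk] := @Eprod_balance s t.
- by rewrite size_cat !size_nseq subnK // ltnW.
- rewrite big_cat /= !sum_nseq_int -/sg sgE -subzn ?(ltnW rd) //.
  by ring.
rewrite -(subrK (v ^ k * Eprod t) (Eprod s)); apply: vspanD.
  apply: vspan_mono hk => Y [[u su ->]|zY]; last by apply: vspan_gen; right.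
  by apply: IHn; apply: leq_trans su _.
apply/vspanV/vspan_gen; left; exists q, (d - r)%N, r.
by rewrite Eprod_cat !Eprod_nseq.
Qed.

(** * The algebra is spanned by [Bset] *)

Local Notation Bspan := (vspan (Bset v x1 x2)).

Lemma cluster_monomial k a b : Bspan (X k ^+ a * X (k + 1) ^+ b).
Proof.
apply: (@vspanVE _ (- (a%:Z * b%:Z))); apply: vspan_gen; left.
by exists k, a, b; rewrite mulrA.
Qed.

(** Replacing one [E_i E_{i+1}] by [v O_i + 1] lowers both outer exponents; once one of them is
    zero, a monomial in a single cluster is left. *)
Lemma EOE_Bspan i a c b : Bspan (E i ^+ a * O i ^+ c * E (i + 1) ^+ b).
Proof.
elim: a c b => [|a IHa] c [|b].
- by rewrite mul1r; have := cluster_monomial (2 * i) 0 c; rewrite mul1r mulr1.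
- by rewrite mul1r; have := cluster_monomial (2 * i + 1) c b.+1; rewrite mulrDr -addrA.
- by rewrite mulr1; apply: cluster_monomial.
have EOc : E i * O i ^+ c = v ^ (2 * c%:Z) * (O i ^+ c * E i).
  have := commutationX (model_EO i) 1 c%:Z; rewrite expr1z -exprnP => ->.
  rewrite (vzD M) (_ : 2 * c%:Z + _ = 0) ?expr0z ?mul1r //; lia.
rewrite exprSr -(mulrA _ (E i)) EOc (mulvzA M) exprS -!(mulrA (v ^ _)).
apply: vspanV; rewrite (_ : _ * _ = v ^ 1 * (E i ^+ a * O i ^+ c.+1 * E (i + 1) ^+ b) +
   E i ^+ a * O i ^+ c * E (i + 1) ^+ b).
  by apply: vspanD; first apply: vspanV.
have -> : v ^ 1 * (E i ^+ a * O i ^+ c.+1 * E (i + 1) ^+ b) =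
    E i ^+ a * O i ^+ c * (v * O i) * E (i + 1) ^+ b.
  rewrite (exprSr (O i)); move: (E i ^+ a) (O i ^+ c) (E (i + 1) ^+ b) => p q r.
  by have := mulvzA M 1 (p * q) (O i); rewrite expr1z => ->; rewrite !mulrA.
by rewrite -mulrDl -[X in _ = (_ + X) * _]mulr1 -mulrDr -exch_EE !mulrA.
Qed.

Lemma cheb_z n : vspan (fun Y => exists m, Y = chebF m z) (chebF n z * z).
Proof.
have gen m : vspan (fun Y => exists m, Y = chebF m z) (chebF m z).
  by apply: vspan_gen; exists m.
case: n => [|[|n]].
- by rewrite mul1r; apply: (gen 1%N).
- rewrite (_ : _ * _ = chebF 2 z + (1 + 1)); last by rewrite /= subrK.
  (* [F_2] has constant term -2, so the remainder is [F_0 + F_0]. *)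
  by apply: vspanD (gen 2%N) _; apply: vspanD; apply: (gen 0%N).
rewrite (_ : _ * _ = chebF n.+3 z + chebF n.+1 z); last by rewrite /= subrK.
exact: vspanD.
Qed.

Lemma zpow_Bspan n : Bspan (z ^+ n).
Proof.
have : vspan (fun Y => exists m, Y = chebF m z) (z ^+ n).
  elim: n => [|n IHn]; first by apply: vspan_gen; exists 0%N.
  by rewrite exprSr; apply: vspan_mulr IHn => _ [m ->]; apply: cheb_z.
apply: vspan_mono => _ [[|m] ->].
  (* [F_0 = 1] is not among the [F_n] of [Bset] but is the trivial cluster monomial. *)
  by have := cluster_monomial 0 0 0; rewrite mulr1.
by apply: vspan_gen; right; exists m.+1.
Qed.

Lemma inA_Bspan Y : inA v x1 x2 Y -> Bspan Y.
Proof.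
pose EP Z := exists s, Z = Eprod s.
have one : vspan EP 1 by apply: vspan_gen; exists [::]; rewrite /Eprod big_nil.
have EE i : vspan EP (E i) by apply: vspan_gen; exists [:: i]; rewrite /Eprod big_seq1.
have mulEP Z T : vspan EP Z -> vspan EP T -> vspan EP (Z * T).
  move=> hZ hT; apply: vspan_mulr hZ => _ [s ->]; apply: vspan_mull hT => _ [t ->].
  by apply: vspan_gen; exists (s ++ t); rewrite Eprod_cat.
move=> AY; have : vspan EP Y.
  elim: AY => {Y} [k||||Y Z _ ? _ ?|Y _ ?|Y Z _ ? _ ?].
  - have [i [->|->]] := int_parity k; first exact: EE.
    apply: (@vspanVE _ 1); rewrite expr1z -[v * _](addrK 1) -exch_EE.
    by apply: vspanB => //; apply: mulEP.
  - exact: one.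
  - by rewrite -[v](mulr1) -[v in v * _]expr1z; apply: vspanV.
  - by rewrite -[v^-1]mulr1 -[v^-1]/(v ^ (-1)); apply: vspanV.
  - exact: vspanD.
  - exact: vspanN.
  - exact: mulEP.
apply: vspan_mono => _ [s ->]; apply: vspan_mono (Eprod_sorted s) => _ [[i [a [b ->]]]|[n ->]].
  by have := EOE_Bspan i a 0 b; rewrite mulr1.
exact: zpow_Bspan.
Qed.

(** * [Bset] lies in the algebra *)

Local Notation inA := (inA v x1 x2).

Lemma inA_exp Y n : inA Y -> inA (Y ^+ n).
Proof. by move=> hY; elim: n => [|n IHn]; [apply: inA_1|rewrite exprS; apply: inA_mul]. Qed.

Lemma inA_vz k : inA (v ^ k).
Proof.
case: k => n; first by apply: inA_exp; apply: inA_v.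
by rewrite NegzE -exprnN -exprVn; apply: inA_exp; apply: inA_vinv.
Qed.

Lemma inA_delta : inA z.
Proof.
have <- : v ^ 1 * defect 0 1 = z.
  by rewrite (defect_next 0) (vzD M) subrr expr0z mul1r.
have EA i : inA (E i) by apply: inA_X.
rewrite /defect; apply: inA_mul; first exact: inA_vz.
apply: inA_add; first exact: inA_mul.
by apply/inA_opp/inA_mul; [apply: inA_vz|apply: inA_mul].
Qed.

Lemma inA_cheb n : inA (chebF n z).
Proof.
suff [] : inA (chebF n z) /\ inA (chebF n.+1 z) by [].
elim: n => [|n [h1 h2]]; first by split; [apply: inA_1|apply: inA_delta].
split=> //; case: n h1 h2 => [|n] h1 h2.
  apply: inA_add; first by apply: inA_mul; apply: inA_delta.
  by apply: inA_opp; apply: inA_add; apply: inA_1.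
by apply: inA_add; [apply: inA_mul h2 inA_delta | apply: inA_opp].
Qed.

Lemma Bset_inA Y : Bset v x1 x2 Y -> inA Y.
Proof.
case=> [[m [a [b ->]]]|[n [_ ->]]]; last exact: inA_cheb.
apply: inA_mul; last by apply/inA_exp/inA_X.
by apply: inA_mul; [apply: inA_vz | apply/inA_exp/inA_X].
Qed.

(** * Laurent expansions in every cluster *)

Local Notation Lm m := (laurent v (X m) (X (m + 1))).

Lemma laurent_mul m Y Z : Lm m predT Y -> Lm m predT Z -> Lm m predT (Y * Z).
Proof. by apply: laurentM => //; apply: cl_model. Qed.

Lemma laurent_v m G k Y : Lm m G Y -> Lm m G (v ^ k * Y).
Proof.
move=> hY; rewrite (mono_v v (X m) (X (m + 1))).
apply: (@laurentM _ _ _ _ (cl_model m) (pred1 (0, 0)) G) hY; last exact: laurent_mono.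
by move=> a b a' b' /= /eqP [-> ->]; rewrite !add0r.
Qed.

Lemma laurent_sym (v' x y : D) (G G' : pred (int * int)) Y :
  qtorus_model v' x y -> (forall a b, G (a, b) -> G' (b, a)) ->
  laurent v'^-1 y x G Y -> laurent v' x y G' Y.
Proof.
move=> M' GG [s [Gs ->]]; apply: laurent_sum => -[c [[k a] b]] /Gs /GG Gt _.
apply: laurent_int; rewrite /qmono /= exprz_inv -mulrA (commutationX M') (vzD M') mulrA.
exact: (@laurent_mono _ _ _ _ _ (- k + -2 * a * b) b a).
Qed.

(** For the weights [(2, 1)] no term of [z] has positive weight, and weight 0 is attained exactly by
    two mutually inverse monomials. [delta_even] is the analogue with weights [(1, 2)]. *)
Lemma delta_odd i (u := qmono v (O i) (X (2 * i + 1 + 1)) (2, 1, -2)) :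
  Lm (2 * i + 1) (wlt 2 1 0) (z - (u + u^-1)).
Proof.
rewrite /u; have -> : 2 * i + 1 + 1 = 2 * (i + 1) by lia.
have uV : (qmono v (O i) (E (i + 1)) (2, 1, -2))^-1 = qmono v (O i) (E (i + 1)) (2, -1, 2).
  by rewrite (monoV (model_OE i)).
rewrite -(delta_cl i) (delta_laurent (model_OE i)) uV.
rewrite (addrC (qmono _ _ _ (2, 1, -2))) (addrAC (_ + qmono _ _ _ (2, 1, -2))) subrr add0r.
by do ?[apply: laurentD]; apply: laurent_mono.
Qed.

Lemma delta_even i (u := qmono v (E i) (O i) (2, 2, -1)) :
  Lm (2 * i) (wlt 1 2 0) (z - (u + u^-1)).
Proof.
have mE a b : qmono v^-1 (O i) (E i) (2, a, b) = qmono v (E i) (O i) (-2 - 2 * a * b, b, a).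
  rewrite /qmono /= exprz_inv -mulrA (commutationX (model_EO i)) (vzD M) mulrA.
  by congr (v ^ _ * _ * _); lia.
have M' := qtorus_sym (model_EO i).
have uV : u^-1 = qmono v (E i) (O i) (2, -2, 1) by rewrite (monoV (model_EO i)).
rewrite uV /u -(delta_clV i) (delta_laurent M') !mE.
rewrite (addrAC (_ + qmono _ _ _ (_, -2, 1))) subrr add0r.
apply: (@laurent_sym v _ _ (wlt 2 1 0)) (model_EO i) _ _ => [a b /=|]; first by lia.
by do ?[apply: laurentD]; apply: laurent_mono.
Qed.

Lemma laurent_delta m : Lm m predT z.
Proof.
have inv (t : int * int * int) :
    Lm m predT (qmono v (X m) (X (m + 1)) t + (qmono v (X m) (X (m + 1)) t)^-1).
  case: t => [[k a] b]; rewrite (monoV (cl_model m)).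
  by apply: laurentD; apply: laurent_mono.
have [i [mE|mE]] := int_parity m; rewrite mE in inv *.
  by apply: laurent_subK (inv _); apply: laurentW (delta_even i).
by apply: laurent_subK (inv _); apply: laurentW (delta_odd i).
Qed.

Lemma laurent_X m : Lm m predT (X m).
Proof. by rewrite -[X in laurent _ _ _ _ X]expr1z (mono_x v (X m) (X (m + 1))); apply: laurent_mono. Qed.

Lemma laurent_XS m : Lm m predT (X (m + 1)).
Proof. by rewrite -[X in laurent _ _ _ _ X]expr1z (mono_y v (X m) (X (m + 1))); apply: laurent_mono. Qed.

(** Since [z] has a Laurent expansion in the cluster, [z E_i = v E_{i-1} + v^-1 E_{i+1}] produces
    all [E_j] from two consecutive ones without division. *)
Lemma laurent_E m j : Lm m predT (E j).
Proof.
suff: exists i, Lm m predT (E i) /\ Lm m predT (E (i + 1)).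
  case=> i; suff: Lm m predT (E i) /\ Lm m predT (E (i + 1)) ->
    Lm m predT (E (i + (j - i))) /\ Lm m predT (E (i + (j - i) + 1)).
    by move=> h /h []; rewrite addrCA subrr addr0.
  elim/int_rect: (j - i) => [|n IHn|n IHn]; first by rewrite addr0.
    move=> /IHn {IHn} [h1 h2].
    have -> : i + n.+1%:Z = i + n%:Z + 1 by lia.
    split=> //; have := delta_Ez (i + n%:Z + 1); rewrite addrK => h.
    have -> : E (i + n%:Z + 1 + 1) = v ^ 1 * (z * E (i + n%:Z + 1) - v ^ 1 * E (i + n%:Z)).
      by rewrite h (addrC (v ^ 1 * _)) addrK (vzD M) subrr expr0z mul1r.
    apply/laurent_v/laurentB; last exact: laurent_v.
    by apply: laurent_mul => //; apply: laurent_delta.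
  move=> /IHn {IHn} [h1 h2].
  have -> : i - n.+1%:Z + 1 = i - n%:Z by lia.
  have -> : i - n.+1%:Z = i - n%:Z - 1 by lia.
  split=> //; have := delta_Ez (i - n%:Z) => h.
  have -> : E (i - n%:Z - 1) = v ^ (-1) * (z * E (i - n%:Z) - v ^ (-1) * E (i - n%:Z + 1)).
    by rewrite h addrK (vzD M) addNr expr0z mul1r.
  apply/laurent_v/laurentB; last exact: laurent_v.
  by apply: laurent_mul => //; apply: laurent_delta.
(* One even variable belongs to the cluster, and the other is one exchange away. *)
have [i [->|->]] := int_parity m; exists i.
  split; first exact: laurent_X.
  rewrite (mutation_laurent (n := 1) (model_EO i) (exch_EE i)).
  by apply: laurentD; apply: laurent_mono.
have e : 2 * i + 1 + 1 = 2 * (i + 1) by lia.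
rewrite -e; split; last exact: laurent_XS.
rewrite e (prev_laurent (model_OE i) (exch_EE i)).
by apply: laurentD; apply: laurent_mono.
Qed.

Lemma laurent_cl m k : Lm m predT (X k).
Proof.
have [i [->|->]] := int_parity k; first exact: laurent_E.
have -> : O i = v ^ (-1) * (E i * E (i + 1) - 1).
  by rewrite exch_EE addrK -[X in X * O i]expr1z (vzD M) addNr expr0z mul1r.
apply/laurent_v/laurentB; first by apply: laurent_mul; apply: laurent_E.
by rewrite -(mono0 v (X m) (X (m + 1))); apply: laurent_mono.
Qed.

(** * Degrees of the cluster variables *)

(* The tropical exchange relations [w_{k-1} + w_{k+1} = max (c_k w_k) 0] are
   solved by [w_k = |n k - s| - n] for [k] even and twice that for [k] odd,
   whatever [n > 0] and [s]; here [s = n k0 + e]. *)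
Definition hgt (n : nat) (e k0 k : int) : int := `|n%:Z * (k - k0) - e| - n%:Z.

Definition twt (n : nat) (e k0 k : int) : int :=
  if odd `|k|%N then 2 * hgt n e k0 k else hgt n e k0 k.

Lemma hgt_trop n e k0 k :
  hgt n e k0 (k - 1) + hgt n e k0 (k + 1) = 2 * Num.max (hgt n e k0 k) 0.
Proof.
rewrite /hgt; have -> : n%:Z * (k - 1 - k0) = n%:Z * (k - k0) - n%:Z by ring.
have -> : n%:Z * (k + 1 - k0) = n%:Z * (k - k0) + n%:Z by ring.
by move: (n%:Z * (k - k0)) => t; lia.
Qed.

(** [n] does not divide [e], so [n t - e] is never [n] or [-n]. Nonzero weights ensure that the two
    terms of an exchange relation have different degrees. *)
Lemma hgt_neq0 n e k0 k : (2 < n)%N -> `|e| = 1 -> hgt n e k0 k != 0.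
Proof.
move=> n2 e1; rewrite /hgt; apply/eqP; move: (k - k0) => t.
have : t <= -2 \/ t = -1 \/ t = 0 \/ t = 1 \/ 2 <= t by lia.
by case=> [t2|[->|[->|[->|t2]]]]; nia.
Qed.

Lemma twt_trop n e k0 k :
  twt n e k0 (k - 1) + twt n e k0 (k + 1) = Num.max ((expo k)%:Z * twt n e k0 k) 0.
Proof.
have := hgt_trop n e k0 k; rewrite /twt /expo.
have -> : odd `|k - 1| = ~~ odd `|k| by lia.
have -> : odd `|k + 1| = ~~ odd `|k| by lia.
by case: odd => /=; lia.
Qed.

Lemma twt_neq0 n e k0 k : (2 < n)%N -> `|e| = 1 -> twt n e k0 k != 0.
Proof. by move=> n2 e1; have := hgt_neq0 k0 k n2 e1; rewrite /twt; case: odd; lia. Qed.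

(** Propagation from the cluster in both directions: one term dominates the right side of each
    exchange relation, with the tropical weight, and [lead_div] applies because the unknown variable
    has a Laurent expansion. *)
Lemma lead_cl n e k0 m k : (2 < n)%N -> `|e| = 1 ->
  has_lead v (X m) (X (m + 1)) (twt n e k0 m) (twt n e k0 (m + 1)) (twt n e k0 k) (X k).
Proof.
move=> n2 e1; set W := twt n e k0.
pose ld := has_lead v (X m) (X (m + 1)) (W m) (W (m + 1)).
have Mm := cl_model m.
have lexch j l : ld (W j) (X j) -> ld (Num.max ((expo j)%:Z * W j) 0) (v ^ l * X j ^+ expo j + 1).
  move=> lj; have {}lj := leadV Mm l (leadX Mm (expo j) lj).
  have Wj : W j != 0 by apply: twt_neq0.
  have ej : (0 < expo j)%N by rewrite /expo; case: odd.
  have [Wp|Wn] := leP 0 (W j).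
    have W0 : 0 < (expo j)%:Z * W j by nia.
    rewrite max_l ?ltW //; apply: leadDl lj _; rewrite -(mono0 v (X m) (X (m + 1))).
    by apply: laurent_mono; rewrite /= !mulr0.
  have W0 : (expo j)%:Z * W j < 0 by nia.
  rewrite max_r ?ltW // addrC; apply: leadDl; first exact: lead1.
  exact: lead_lt lj.
have up j : ld (W (j - 1)) (X (j - 1)) -> ld (W j) (X j) -> ld (W (j + 1)) (X (j + 1)).
  move=> h1 h2; have -> : W (j + 1) = Num.max ((expo j)%:Z * W j) 0 - W (j - 1).
    by rewrite /W -twt_trop addrAC subrr add0r.
  exact (lead_div Mm (laurent_cl m _) h1 (lexch j (expo j)%:Z h2) (cl_exch j)).
have down j : ld (W j) (X j) -> ld (W (j + 1)) (X (j + 1)) -> ld (W (j - 1)) (X (j - 1)).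
  move=> h1 h2; have -> : W (j - 1) = Num.max ((expo j)%:Z * W j) 0 - W (j + 1).
    by rewrite /W -twt_trop addrK.
  have xe : X (j + 1) * X (j - 1) = v ^ (- (expo j)%:Z) * X j ^+ expo j + 1.
    by rewrite cl_exchV -exprz_inv.
  exact (lead_div Mm (laurent_cl m _) h2 (lexch j (- (expo j)%:Z) h1) xe).
suff: ld (W (m + (k - m))) (X (m + (k - m))) /\ ld (W (m + (k - m) + 1)) (X (m + (k - m) + 1)).
  by rewrite addrCA subrr addr0 => -[].
elim/int_rect: (k - m) => [|i [h1 h2]|i [h1 h2]].
- rewrite addr0; split.
    have := lead_mono v (X m) (X (m + 1)) (W m) (W (m + 1)) 0 1 0.
    by rewrite -mono_x expr1z mulr1 mulr0 addr0.
  have := lead_mono v (X m) (X (m + 1)) (W m) (W (m + 1)) 0 0 1.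
  by rewrite -mono_y expr1z mulr1 mulr0 add0r.
- have -> : m + i.+1%:Z = m + i%:Z + 1 by lia.
  by split=> //; apply: up => //; rewrite addrK.
- have -> : m - i.+1%:Z + 1 = m - i%:Z by lia.
  split=> //; have -> : m - i.+1%:Z = m - i%:Z - 1 by lia.
  exact: down.
Qed.

(** * Expansions all of whose terms have a negative exponent *)

Definition improper (g : int * int) : bool := ~~ ((0 <= g.1) && (0 <= g.2)).

Lemma clmon_wlt n e k0 m k a b w : (2 < n)%N -> `|e| = 1 ->
  a%:Z * twt n e k0 k + b%:Z * twt n e k0 (k + 1) < w ->
  Lm m (wlt (twt n e k0 m) (twt n e k0 (m + 1)) w) (X k ^+ a * X (k + 1) ^+ b).
Proof.
move=> n2 e1; have Mm := cl_model m; move=> /lead_lt; apply.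
by apply: leadM => //; apply: leadX => //; apply: lead_cl.
Qed.

Lemma improper_wlt m al be Y : 0 < al -> 0 < be -> Lm m (wlt al be 0) Y -> Lm m improper Y.
Proof.
move=> al0 be0; apply: laurentW => a b /=; rewrite /improper /=.
by case: (leP 0 a) => //= a0; case: (leP 0 b) => //= b0; nia.
Qed.

Lemma improper_right m k a b : k < m -> (0 < a)%N ->
  Lm m improper (X k ^+ a * X (k + 1) ^+ b).
Proof.
(* With [e = -1] the heights of [X_k] and [X_{k+1}] are [1 - n] and 1, and those beyond are
   positive. This [n] lets one factor [X_k] outweigh [b] factors [X_{k+1}], even with odd indices
   doubled. *)
move=> km a0; pose n := (2 * b + 3)%N.
have n2 : (2 < n)%N by rewrite /n; lia.
have hpos j : k < j -> 0 < twt n (-1) k j.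
  move=> kj; rewrite /twt /hgt; have : n%:Z <= n%:Z * (j - k) by nia.
  by move: (n%:Z * _) => t; case: odd; lia.
apply: (improper_wlt (hpos _ km) (hpos (m + 1) _)); first by lia.
apply: clmon_wlt => //; rewrite /twt /hgt.
have -> : n%:Z * (k - k) = 0 by ring.
have -> : n%:Z * (k + 1 - k) = n%:Z by ring.
by rewrite /n; case: odd; case: odd; nia.
Qed.

Lemma improper_left m k a b : m < k -> (0 < b)%N ->
  Lm m improper (X k ^+ a * X (k + 1) ^+ b).
Proof.
(* Mirror image: with [e = 1] around [k + 1] the heights of [X_{k+1}] and [X_k] are [1 - n] and
   1. *)
move=> mk b0; pose n := (2 * a + 3)%N.
have n2 : (2 < n)%N by rewrite /n; lia.
have hpos j : j <= k -> 0 < twt n 1 (k + 1) j.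
  move=> jk; rewrite /twt /hgt; have : n%:Z * (j - (k + 1)) <= - n%:Z by nia.
  by move: (n%:Z * _) => t; case: odd; lia.
apply: (@improper_wlt _ (twt n 1 (k + 1) m) (twt n 1 (k + 1) (m + 1))).
- by apply: hpos; lia.
- by apply: hpos; lia.
apply: clmon_wlt => //; rewrite /twt /hgt.
have -> : n%:Z * (k + 1 - (k + 1)) = 0 by ring.
have -> : n%:Z * (k - (k + 1)) = - n%:Z by ring.
by rewrite /n; case: odd; case: odd; nia.
Qed.

Lemma mono_exp (x y : D) k a b n : qtorus_model v x y ->
  exists k', qmono v x y (k, a, b) ^+ n = qmono v x y (k', n%:Z * a, n%:Z * b).
Proof.
move=> Mxy; elim: n => [|n [k' IHn]]; first by exists 0; rewrite !mul0r mono0.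
rewrite exprS IHn monoM //; exists (k + k' - 2 * b * (n%:Z * a)).
by congr (qmono _ _ _ (_, _, _)); lia.
Qed.

(** The sums [c n] of [u ^ n] and its inverse obey the Chebyshev recursion, [c 0 = 2] matching the
    constant in [F_2]. As [z] and all [c n] have weight at most 0, errors of negative weight stay
    negative. *)
Lemma cheb_lead m al be k a b (u := qmono v (X m) (X (m + 1)) (k, a, b)) :
  al * a + be * b = 0 -> Lm m (wlt al be 0) (z - (u + u^-1)) ->
  forall n, (0 < n)%N -> Lm m (wlt al be 0) (chebF n z - (u ^+ n + u^-1 ^+ n)).
Proof.
move=> w0 hz; have Mm := cl_model m.
have uu : u \is a GRing.unit by apply: (unit_neq0 Mm); apply: (mono_neq0 Mm).
have lu : has_lead v (X m) (X (m + 1)) al be 0 u by rewrite -w0; apply: lead_mono.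
have luV : has_lead v (X m) (X (m + 1)) al be 0 u^-1.
  rewrite /u (monoV Mm) (_ : 0 = al * - a + be * - b); first exact: lead_mono.
  by rewrite !mulrN -opprD w0 oppr0.
pose c n := u ^+ n + u^-1 ^+ n.
have Rc n : Lm m (wlt al be 1) (c n).
  apply: laurentD; [apply: (lead_lt _ (leadX Mm n lu)) | apply: (lead_lt _ (leadX Mm n luV))].
    by rewrite mulr0.
  by rewrite mulr0.
have Rz : Lm m (wlt al be 1) z.
  rewrite -[z](subrK (u + u^-1)); apply: laurentD; last exact: (Rc 1%N).
  by apply: wt_ltW hz.
have cS n : c n.+1 * c 1%N = c n.+2 + c n.
  have e1 : u ^+ n.+1 * u^-1 = u ^+ n by rewrite exprSr mulrK.
  have e2 : u^-1 ^+ n.+1 * u = u^-1 ^+ n by rewrite exprSr mulrVK.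
  by rewrite /c !expr1 mulrDl !mulrDr e1 e2 -!exprSr (addrC (u^-1 ^+ n)) addrACA.
have step n : Lm m (wlt al be 0) (chebF n.+1 z - c n.+1) ->
    Lm m (wlt al be 0) (chebF n.+1 z * z - (c n.+2 + c n)).
  move=> h; rewrite -cS (_ : _ - _ = (chebF n.+1 z - c n.+1) * z + c n.+1 * (z - c 1%N)).
    apply: laurentD; first by apply: (wt_ltM Mm _ h Rz).
    by apply: (wt_ltM Mm _ (Rc _) hz).
  by rewrite mulrBl mulrBr addrA subrK.
suff both n : Lm m (wlt al be 0) (chebF n.+1 z - c n.+1) /\
              Lm m (wlt al be 0) (chebF n.+2 z - c n.+2).
  by case=> // n _; have [] := both n.
elim: n => [|n [h1 h2]].
  have h1 : Lm m (wlt al be 0) (chebF 1 z - c 1%N) by [].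
  split=> //; have := step 0%N h1.
  have -> : c 0%N = 2%:R by rewrite /c !expr0.
  rewrite -[chebF 2 z]/(z * z - 2%:R) -[chebF 1 z]/z opprD.
  by move: (z * z) (c 2%N) => p q; rewrite addrA addrAC.
split=> //; have := laurentB (step _ h2) h1.
rewrite -[chebF n.+3 z]/(chebF n.+2 z * z - chebF n.+1 z).
move: (chebF n.+2 z * z) (chebF n.+1 z) (c n.+3) (c n.+1) => p q r t.
by rewrite opprB opprD !addrA subrK addrAC.
Qed.

(** The two terms of weight 0 have exponents of opposite signs, and all others have negative weight
    for positive [al] and [be]. *)
Lemma improper_cheb m n : (0 < n)%N -> Lm m improper (chebF n z).
Proof.
move=> n0; have Mm := cl_model m.
suff [al [be [k [a [b [al0 be0 ab ab0 h]]]]]] : exists al be k a b,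
    [/\ 0 < al, 0 < be, a * b < 0, al * a + be * b = 0 &
     Lm m (wlt al be 0) (z - (qmono v (X m) (X (m + 1)) (k, a, b)
        + (qmono v (X m) (X (m + 1)) (k, a, b))^-1))].
  have {}h := cheb_lead ab0 h n0.
  apply: laurent_subK; first exact: improper_wlt h.
  have [l ->] := mono_exp k a b n Mm; rewrite (monoV Mm).
  have [l' ->] := mono_exp (- k - 2 * a * b) (- a) (- b) n Mm.
  by apply: laurentD; apply: laurent_mono; rewrite /improper /=; nia.
have [i [->|->]] := int_parity m.
  by exists 1, 2, 2, 2, (-1); split=> //; apply: delta_even.
by exists 2, 1, 2, 1, (-2); split=> //; apply: delta_odd.
Qed.

(** * Exponents that isolate one basis element *)

Definition clmon m (a b : nat) : D := v ^ (- (a%:Z * b%:Z)) * X m ^+ a * X (m + 1) ^+ b.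

Lemma clmonE m a b :
  clmon m a b = qmono v (X m) (X (m + 1)) (- (a%:Z * b%:Z), a%:Z, b%:Z).
Proof. by []. Qed.

Lemma clmon00 m : clmon m 0 0 = 1.
Proof. by rewrite /clmon mulr0 oppr0 expr0z !mulr1. Qed.

Lemma clmon_shift m a : clmon m 0 a = clmon (m + 1) a 0.
Proof. by rewrite /clmon mul0r mulr0 oppr0 !expr0z !mulr1 !mul1r. Qed.

Lemma clmon_avoid m a b k a' b' : clmon k a' b' != clmon m a b ->
  Lm m (predC1 (a%:Z, b%:Z)) (clmon k a' b').
Proof.
have same c d : clmon m c d != clmon m a b -> Lm m (predC1 (a%:Z, b%:Z)) (clmon m c d).
  move=> ne; rewrite clmonE; apply: laurent_mono; apply: contraNN ne => /= /eqP [-> ->].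
  by rewrite eqxx.
have imp Y : Lm m improper Y -> Lm m (predC1 (a%:Z, b%:Z)) Y.
  by apply: laurentW => c d; apply: contraNN => /= /eqP [-> ->].
have impcl j c d : Lm m improper (X j ^+ c * X (j + 1) ^+ d) ->
    Lm m (predC1 (a%:Z, b%:Z)) (clmon j c d).
  by move=> h; apply: imp; rewrite /clmon -mulrA; apply: laurent_v.
have [km|mk|->] := ltgtP k m; last exact: same.
- case: a' => [|a'] ne; last by apply/impcl/improper_right.
  (* With a zero exponent the monomial is a power of one variable and is read in the adjacent
     cluster, which may be the cluster [m] itself. *)
  case: b' ne => [|b'] ne; first by move: ne; rewrite clmon00 -(clmon00 m); apply: same.
  move: ne; rewrite clmon_shift => ne.
  have [km1|km1] := eqVneq (k + 1) m; first by rewrite km1 in ne *; apply: same.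
  by apply/impcl/improper_right => //; lia.
- case: b' => [|b'] ne; last by apply/impcl/improper_left.
  case: a' ne => [|a'] ne; first by move: ne; rewrite clmon00 -(clmon00 m); apply: same.
  move: ne; rewrite -[k](subrK 1) -clmon_shift => ne.
  have [km1|km1] := eqVneq (k - 1) m; first by rewrite km1 in ne *; apply: same.
  by apply/impcl/improper_left => //; lia.
Qed.

Lemma far_clmon_avoid i n k a b : 2 * i + 2 < k -> (0 < n)%N ->
  Lm (2 * i + 1) (predC1 (n%:Z, - (2 * n%:Z))) (clmon k a b).
Proof.
move=> ik n0; rewrite /clmon -mulrA; apply: laurent_v.
set m := 2 * i + 1.
(* Around [k] the heights of [X_k] and [X_{k+1}] are -2 and -1. Left of [k] heights drop by 3 per
   step, so the exponent [(n, -2n)] has weight [6n], which is too large. *)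
have neg : a%:Z * twt 3 1 k k + b%:Z * twt 3 1 k (k + 1) < 1.
  rewrite /twt /hgt; have -> : k - k = 0 by lia.
  have -> : k + 1 - k = 1 by lia.
  by case: odd; case: odd; nia.
apply: laurentW (clmon_wlt m _ _ neg) => // c d; apply: contraTN => /= /eqP [-> ->].
rewrite /twt (_ : odd `|m| = true); last by rewrite /m; lia.
rewrite (_ : odd `|m + 1| = false); last by rewrite /m; lia.
by rewrite /hgt /m -leNgt; nia.
Qed.

Lemma cheb_odd i n : (0 < n)%N -> exists l l',
  Lm (2 * i + 1) (wlt 2 1 0) (chebF n z -
    (qmono v (O i) (X (2 * i + 1 + 1)) (l, n%:Z, - (2 * n%:Z)) +
     qmono v (O i) (X (2 * i + 1 + 1)) (l', - n%:Z, 2 * n%:Z))).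
Proof.
move=> n0; have Mm := cl_model (2 * i + 1).
have w0 : 2 * 1 + 1 * -2 = 0 :> int by [].
have := cheb_lead w0 (delta_odd i) n0.
have [l ->] := mono_exp 2 1 (-2) n Mm; rewrite (monoV Mm).
have [l' ->] := mono_exp (- 2 - 2 * 1 * -2) (- 1) (- -2) n Mm => h; exists l, l'.
move: h; congr (laurent _ _ _ _ (_ - (qmono _ _ _ (_, _, _) + qmono _ _ _ (_, _, _)))); lia.
Qed.

(** The support condition on the difference says that the coefficient of [b0] at [g] is a power of
    [v]. *)
Lemma isolating_exponent (b0 : D) (ys : seq D) :
  Bset v x1 x2 b0 -> (forall y, y \in ys -> Bset v x1 x2 y) ->
  exists m (g : int * int) j,
    Lm m (predC1 g) (b0 - qmono v (X m) (X (m + 1)) (j, g.1, g.2)) /\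
    forall y, y \in ys -> y != b0 -> Lm m (predC1 g) y.
Proof.
case=> [[m [a [b ->]]]|[n [n0 ->]]] Bys.
  exists m, (a%:Z, b%:Z), (- (a%:Z * b%:Z)); split.
    by rewrite -/(clmon m a b) clmonE subrr; apply: laurent0.
  move=> y /Bys [[k [a' [b' ->]]]|[n [n0 ->]]] ne; first exact: clmon_avoid.
  by apply: laurentW (improper_cheb m n0) => c d; apply: contraNN => /= /eqP [-> ->].
have [i far] : exists i, forall y, y \in ys ->
    (exists k a b, 2 * i + 2 < k /\ y = clmon k a b) \/
    (exists n', (0 < n')%N /\ y = chebF n' z).
  elim: ys Bys => [|y ys IHys] Bys; first by exists 0.
  have [|i far] := IHys; first by move=> t ts; apply: Bys; rewrite inE ts orbT.
  have [[k [a [b yE]]]|hy] := Bys y (mem_head _ _).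
    (* This choice gives [2 * i + 2 < k] and keeps the bounds already obtained. *)
    exists (Num.min i (- `|k| - 2)) => t /[!inE] /predU1P [->|/far [[k' [a' [b' [ik ->]]]]|]].
    - by left; exists k, a, b; split=> //; lia.
    - by left; exists k', a', b'; split=> //; lia.
    - by right.
  by exists i => t /[!inE] /predU1P [->|/far //]; right.
have [l [l' h]] := cheb_odd i n0.
have low Y : Lm (2 * i + 1) (wlt 2 1 0) Y -> Lm (2 * i + 1) (predC1 (n%:Z, - (2 * n%:Z))) Y.
  by apply: laurentW => c d; apply: contraTN => /= /eqP [-> ->]; lia.
exists (2 * i + 1), (n%:Z, - (2 * n%:Z)), l; split.
  apply: (@laurent_subK _ _ _ _ _ _ (qmono v (O i) (X (2 * i + 1 + 1)) (l', - n%:Z, 2 * n%:Z))).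
    by rewrite -(addrA (chebF n z)) -opprD; apply: low.
  by apply: laurent_mono => /=; apply/eqP => -[]; lia.
move=> y /far [[k [a [b [ik ->]]]] _|[n' [n'0 ->]] ne]; first exact: far_clmon_avoid.
have nn' : n' != n by apply: contraNneq ne => ->.
have [r [r' h']] := cheb_odd i n'0.
apply: laurent_subK; first exact: low h'.
by apply: laurentD; apply: laurent_mono => /=; apply/eqP => -[]; lia.
Qed.

(** * Comparison of coefficients: independence and positivity *)

Lemma laurent_lpval m G p Y : Lm m G Y -> Lm m G (lpval v p * Y).
Proof.
move=> hY; rewrite /lpval mulr_suml; apply: laurent_sum => t _ _.
by rewrite -mulrA; apply: laurent_int; apply: laurent_v.
Qed.

(** Only [b0] contributes at the isolating exponent, up to the unit [v ^ j]. An empty [l] gives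
    linear independence, a positive expansion gives positivity; [l] is quantified after [m] because
    the expansion depends on the cluster. *)
Lemma coefficient (b0 : D) (ys : seq D) (lam : D -> seq (int * int)) :
  uniq ys -> (forall y, y \in ys -> Bset v x1 x2 y) -> b0 \in ys ->
  exists m (g : int * int) j, forall l : seq (nat * int * int * int),
    \sum_(y <- ys) lpval v (lam y) * y =
      \sum_(t <- l) t.1.1.1%:R * v ^ t.1.1.2 * X m ^ t.1.2 * X (m + 1) ^ t.2 ->
    lpval v (lam b0) =
      \sum_(t <- l | (t.1.2, t.2) == g) t.1.1.1%:R * v ^ (t.1.1.2 - j).
Proof.
move=> uys Bys b0s; have [m [g [j [h0 hys]]]] := isolating_exponent (Bys _ b0s) Bys.
exists m, g, j => l; have Mm := cl_model m.
pose mon (t : nat * int * int * int) :=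
  t.1.1.1%:R * v ^ t.1.1.2 * X m ^ t.1.2 * X (m + 1) ^ t.2.
have monE t : mon t = (t.1.1.1%:Z)%:~R * qmono v (X m) (X (m + 1)) (t.1.1.2, t.1.2, t.2).
  by rewrite /mon /qmono /= !mulrA.
have hmon (P : pred (int * int)) : Lm m P (\sum_(t <- l | P (t.1.2, t.2)) mon t).
  by apply: laurent_sum => t _ Pt; rewrite monE; apply/laurent_int/laurent_mono.
set q := qmono v (X m) (X (m + 1)) (j, g.1, g.2) in h0.
rewrite (bigD1_seq b0) //= [RHS](bigID (fun t => (t.1.2, t.2) == g)) /= => YE.
have d0 : lpval v (lam b0) * q - \sum_(t <- l | (t.1.2, t.2) == g) mon t = 0.
  apply: (@laurent_disjoint _ _ _ _ Mm (pred1 g) (predC1 g)).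
  - by move=> a b /= ->.
  - apply: laurentB; last exact: (hmon (pred1 g)).
    by apply: laurent_lpval; apply: laurent_mono => /=; rewrite -surjective_pairing eqxx.
  - rewrite (_ : _ - _ = \sum_(t <- l | (t.1.2, t.2) != g) mon t -
        \sum_(y <- ys | y != b0) lpval v (lam y) * y - lpval v (lam b0) * (b0 - q)).
      apply: laurentB; last exact: laurent_lpval.
      apply: laurentB; first exact: (hmon (predC1 g)).
      by apply: laurent_sum => y sy ny; apply: laurent_lpval; apply: hys.
    rewrite mulrBr opprB; move: YE; rewrite -/mon.
    move: (\sum_(t <- l | _ == g) _) (\sum_(t <- l | _ != g) _) (\sum_(y <- ys | _) _) => A B C.
    move=> /(canRL (addrK _)) ->.
    by rewrite opprB opprD addrCA (addrA (B - C)) subrK (addrC B) subrK.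
have uxy : X m ^ g.1 * X (m + 1) ^ g.2 \is a GRing.unit.
  by rewrite unitrMl; apply/unitrXz/unit_cl.
have uv := unit_v M.
have qE : q = v ^ j * (X m ^ g.1 * X (m + 1) ^ g.2) by rewrite mulrA.
apply: (mulIr (unitrXz j uv)); apply: (mulIr uxy).
rewrite -mulrA -qE (subr0_eq d0) !mulr_suml; apply: eq_bigr => t /eqP <-.
rewrite /mon /= -[_ * _ * v ^ j]mulrA -exprzDr // subrK.
by rewrite !mulrA.
Qed.

Lemma Bset_basis : is_basis v x1 x2 (Bset v x1 x2).
Proof.
split; first exact: Bset_inA.
  by move=> Y /inA_Bspan /vspan_lpval.
move=> ys lam uys Bys s0 y sy.
have [m [g [j /(_ [::])]]] := coefficient lam uys Bys sy.
by rewrite !big_nil => /(_ s0).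
Qed.

Lemma Bset_positive Y : inA Y -> positive v x1 x2 Y ->
  exists l : seq (nat * int * D),
    (forall t, t \in l -> Bset v x1 x2 t.2) /\
    Y = \sum_(t <- l) t.1.1%:R * v ^ t.1.2 * t.2.
Proof.
move=> /inA_Bspan /vspan_lpval [l [Bl YE]] pos.
pose ys := undup [seq t.2 | t <- l].
(* Equal basis elements are merged by concatenating their coefficient lists. *)
pose lam y := flatten [seq t.1 | t <- l & t.2 == y].
have {}YE : Y = \sum_(y <- ys) lpval v (lam y) * y.
  rewrite YE (sum_by_key (fun t => t.2)); apply: eq_bigr => y _.
  rewrite /lpval big_flatten big_map big_filter mulr_suml.
  by apply: eq_bigr => t /eqP ->.
have Bys y : y \in ys -> Bset v x1 x2 y.
  by rewrite mem_undup => /mapP [t /Bl Bt ->].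
rewrite YE [\sum_(y <- ys) _]big_seq.
pose nspan Y := exists l : seq (nat * int * D),
    (forall t, t \in l -> Bset v x1 x2 t.2) /\
    Y = \sum_(t <- l) t.1.1%:R * v ^ t.1.2 * t.2.
apply: (big_ind nspan) => [|Z T [r [Br ->]] [r' [Br' ->]]|y sy].
- by exists [::]; rewrite big_nil.
- exists (r ++ r'); rewrite big_cat; split=> // t.
  by rewrite mem_cat => /orP [/Br|/Br'].
have [m [g [j h]]] := coefficient lam (undup_uniq _) Bys sy.
have [r rE] := pos m; rewrite YE in rE; rewrite (h _ rE).
exists [seq (t.1.1.1, t.1.1.2 - j, y) | t <- r & (t.1.2, t.2) == g]; split.
  by move=> _ /mapP [t _ ->]; apply: Bys.
by rewrite big_map big_filter mulr_suml.
Qed.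

End ClusterVariables.

Theorem theorem3p7 (D : unitRingType) (v x1 x2 : D) :
  qtorus_model v x1 x2 ->
  is_canonical_basis v x1 x2 (Bset v x1 x2).
Proof. by move=> M; split; [apply: Bset_basis | apply: Bset_positive]. Qed.
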